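(* For every integer $n\ge 5$, the representation $\Sigma_n^{(+)}$ of $\widetilde{\mathfrak{spin}}(n)$ is of Lie type if and only if $n\in\{5,6,8,9,10,12,16\}$.
   Context: Let $\mathrm{Cl}_n$ be the real Clifford algebra of Euclidean $\mathbb{R}^n$ with the sign convention $\mathrm{Cl}_1\cong\mathbb{C}$, $\mathrm{Cl}_2\cong\mathbb{H}$ (unit vectors square to $-1$). The Clifford representation of $\mathrm{Cl}_n$ is its unique irreducible real representation if $n\not\equiv 3\pmod 4$, and the direct sum of its two inequivalent irreducible real representations if $n\equiv 3\pmod 4$. The real spinor representation $\Sigma_n$ is the restriction of the Clifford representation of $\mathrm{Cl}_{n-1}$ to $\mathfrak{spin}(n)\subset\mathrm{Cl}_{n-1}$ (using $\mathrm{Cl}_{n-1}\cong \mathrm{Cl}_n^{\mathrm{even}}$). It is irreducible for $n\not\equiv0\pmod4$, and for $n\equiv 0\pmod 4$ it is the direct sum of two irreducible representations $\Sigma_n=\Sigma_n^+\oplus\Sigma_n^-$. Set $\Sigma_n^{(+)}:=\Sigma_n^+$ if $n\equiv0\pmod4$ and $\Sigma_n^{(+)}:=\Sigma_n$ otherwise. This irreducible real representation is of real type (commutant $\mathbb{R}$) for $n\equiv0,1,7\pmod 8$, of complex type (commutant $\mathbb{C}$) for $n\equiv 2,6\pmod 8$, and of quaternionic type (commutant $\mathbb{H}$) for $n\equiv3,4,5\pmod 8$. Define $$\widetilde{\mathfrak{spin}}(n):=\begin{cases}\mathfrak{spin}(n)& n\equiv 0,1,7 \pmod 8,\\ \mathfrak{spin}(n)\oplus\mathfrak{u}(1)&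 n\equiv 2,6\pmod 8,\\ \mathfrak{spin}(n)\oplus\mathfrak{sp}(1)& n\equiv3,4,5\pmod 8,\end{cases}$$ acting on $\Sigma_n^{(+)}$, where the $\mathfrak{u}(1)$ or $\mathfrak{sp}(1)$ summand acts through the complex structure, respectively the quaternionic structure (imaginary unit quaternions in the commutant). A representation $\mathfrak{m}$ of a real Lie algebra $\mathfrak{h}$ of compact type is of Lie type if there exist an $\mathrm{ad}_{\mathfrak{h}}$-invariant Euclidean product $B_{\mathfrak{h}}$ on $\mathfrak{h}$, an $\mathfrak{h}$-invariant Euclidean product $B_{\mathfrak{m}}$ on $\mathfrak{m}$, and a Lie algebra structure $[\cdot,\cdot]$ on $\mathfrak{g}:=\mathfrak{h}\oplus\mathfrak{m}$ such that: (1) $[\cdot,\cdot]$ restricted to $\mathfrak{h}$ is the Lie bracket of $\mathfrak{h}$; (2) $[a,v]=-[v,a]=av$ for all $a\in\mathfrak{h}$, $v\in\mathfrak{m}$; (3) $B_{\mathfrak{h}}(a,[v,w])=B_{\mathfrak{m}}(av,w)$ for all $a\in\mathfrak{h}$, $v,w\in\mathfrak{m}$, where $B_{\mathfrak{h}}(a,[v,w])$ is the pairing of $a$ with the $\mathfrak{h}$-component of $[v,w]$. (It is not required that $[\mathfrak{m},\mathfrak{m}]\subset\mathfrak{h}$.) *)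

(* Defs.v *)
From HB Require Import structures.
From mathcomp Require Import all_boot all_order all_algebra.
From mathcomp Require Import reals ring.

Set Implicit Arguments.
Unset Strict Implicit.
Unset Printing Implicit Defensive.

Import Order.TTheory GRing.Theory Num.Theory.
Local Open Scope ring_scope.

(* Real Clifford algebra with e_i ^ 2 = -1 (see clgen_relation).
   An element is the family of its coordinates on the basis
   e_A = e_{i_1} * ... * e_{i_r}, for A = {i_1 < ... < i_r} a subset of 'I_n.
   The alias hides the pointwise product of {ffun _ -> _}. *)
Definition Cl (R : realType) (n : nat) : Type := {ffun {set 'I_n} -> R^o}.

HB.instance Definition _ (R : realType) (n : nat) :=
  Vector.copy (Cl R n) {ffun {set 'I_n} -> R^o}.

Section CliffordProduct.
Context {R : realType} {n : nat}.
Implicit Types (A B C : {set 'I_n}) (x y z : Cl R n).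

Definition clbase A : Cl R n := [ffun B => (B == A)%:R].

Definition symdiff A B : {set 'I_n} := [set i | (i \in A) (+) (i \in B)].

(* Sorting e_A * e_B takes one sign change for every pair i > j with i in A and
   j in B, and one more for every square e_i * e_i = -1. *)
Definition clsign A B : nat := \sum_(i in A) \sum_(j in B) (j <= i).

Definition clmul x y : Cl R n :=
  \sum_A \sum_B (x A * y B * (-1) ^+ clsign A B) *: clbase (symdiff A B).

Lemma clbaseE x : x = \sum_A x A *: clbase A.
Proof.
apply/ffunP => B; rewrite sum_ffunE (bigD1 B) //= big1 ?addr0.
  by rewrite !ffunE eqxx /GRing.scale /= mulr1.
by move=> A neAB; rewrite !ffunE eq_sym (negbTE neAB) scaler0.
Qed.

Lemma clmul_base A B :
  clmul (clbase A) (clbase B) = (-1) ^+ clsign A B *: clbase (symdiff A B).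
Proof.
rewrite /clmul (bigD1 A) //= (bigD1 B) //= !ffunE !eqxx !mul1r.
rewrite !big1 ?addr0 // => [C neCA|C neCB].
  by apply: big1 => D _; rewrite !ffunE (negbTE neCA) !mul0r scale0r.
by rewrite !ffunE (negbTE neCB) mulr0 mul0r scale0r.
Qed.

Lemma clmul_linearl y : linear (clmul^~ y).
Proof.
move=> a x x'; rewrite /clmul scaler_sumr -big_split; apply: eq_bigr => A _ /=.
rewrite scaler_sumr -big_split; apply: eq_bigr => B _ /=.
by rewrite !ffunE scalerA -scalerDl !mulrDl !mulrA.
Qed.

Lemma clmul_linearr x : linear (clmul x).
Proof.
move=> a y y'; rewrite /clmul scaler_sumr -big_split; apply: eq_bigr => A _ /=.
rewrite scaler_sumr -big_split; apply: eq_bigr => B _ /=.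
rewrite !ffunE scalerA -scalerDl mulrDr !mulrDl; congr ((_ + _) *: _).
by rewrite /GRing.scale /= !mulrA (mulrC (x A)).
Qed.

Lemma clmulDl : left_distributive clmul +%R.
Proof. by move=> x x' y; rewrite -[x]scale1r clmul_linearl !scale1r. Qed.

Lemma clmulDr : right_distributive clmul +%R.
Proof. by move=> x y y'; rewrite -[y]scale1r clmul_linearr !scale1r. Qed.

Lemma clmulZl y a x : clmul (a *: x) y = a *: clmul x y.
Proof. exact: (GRing.scalable_linear (clmul_linearl y)). Qed.

Lemma clmulZr x a y : clmul x (a *: y) = a *: clmul x y.
Proof. exact: (GRing.scalable_linear (clmul_linearr x)). Qed.

Lemma clbase_ind (P : Cl R n -> Prop) :
    (forall A, P (clbase A)) -> (forall a x y, P x -> P y -> P (a *: x + y)) ->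
  forall x, P x.
Proof.
move=> Pb PD x; rewrite [x]clbaseE.
have P0 : P 0 by rewrite -(addNr (clbase set0)) -scaleN1r; apply: PD.
elim/big_ind: _ => // [y z Py Pz|A _].
  by rewrite -[y]scale1r; apply: PD.
by rewrite -[_ *: _]addr0; apply: PD.
Qed.

Lemma symdiffA : associative symdiff.
Proof. by move=> A B C; apply/setP => i; rewrite !inE addbA. Qed.

Lemma symdiffC : commutative symdiff.
Proof. by move=> A B; apply/setP => i; rewrite !inE addbC. Qed.

Lemma symdiff0 A : symdiff A set0 = A.
Proof. by apply/setP => i; rewrite !inE addbF. Qed.

Lemma odd_sum (I : finType) (P : pred I) (F : I -> nat) :
  odd (\sum_(i | P i) F i) = \big[addb/false]_(i | P i) odd (F i).
Proof. by apply: (big_morph odd) => // a b; rewrite oddD. Qed.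

Lemma odd_clsign A B : odd (clsign A B) =
  \big[addb/false]_i \big[addb/false]_j [&& i \in A, j \in B & (j <= i)%N].
Proof.
rewrite odd_sum big_mkcond; apply: eq_bigr => i _.
rewrite odd_sum; case: ifP => iA; last by rewrite big1.
rewrite big_mkcond; apply: eq_bigr => j _ /=.
by case: ifP => //; case: (_ <= _)%N.
Qed.

Lemma odd_clsignDl A B C :
  odd (clsign (symdiff A B) C) = odd (clsign A C) (+) odd (clsign B C).
Proof.
rewrite !odd_clsign -big_split; apply: eq_bigr => i _ /=.
rewrite -big_split; apply: eq_bigr => j _ /=.
by rewrite inE; do 2!case: (i \in _) => //=; rewrite ?addbb ?addbF.
Qed.

Lemma odd_clsignDr A B C :
  odd (clsign A (symdiff B C)) = odd (clsign A B) (+) odd (clsign A C).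
Proof.
rewrite !odd_clsign -big_split; apply: eq_bigr => i _ /=.
rewrite -big_split; apply: eq_bigr => j _ /=; case: (i \in A) => //=.
by rewrite inE; do 2!case: (j \in _) => //=; rewrite ?addbb ?addbF.
Qed.

Lemma clmulA : associative clmul.
Proof.
move=> x y z; elim/clbase_ind: x => [A|a x x' IHx IHx']; last first.
  by rewrite !clmul_linearl IHx IHx'.
elim/clbase_ind: y => [B|a y y' IHy IHy']; last first.
  by rewrite clmul_linearl !clmul_linearr clmul_linearl IHy IHy'.
elim/clbase_ind: z => [C|a z z' IHz IHz']; last first.
  by rewrite !clmul_linearr IHz IHz'.
rewrite !clmul_base clmulZl clmulZr !clmul_base !scalerA symdiffA.
congr (_ *: _); rewrite -!exprD -signr_odd -[RHS]signr_odd !oddD.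
by rewrite odd_clsignDl odd_clsignDr; congr (_ ^+ nat_of_bool _);
   do 3!case: (odd _).
Qed.

Lemma clmul1r : left_id (clbase set0) clmul.
Proof.
move=> x; elim/clbase_ind: x => [A|a x x' IHx IHx']; last first.
  by rewrite clmul_linearr IHx IHx'.
by rewrite clmul_base symdiffC symdiff0 /clsign big_set0 scale1r.
Qed.

Lemma clmulr1 : right_id (clbase set0) clmul.
Proof.
move=> x; elim/clbase_ind: x => [A|a x x' IHx IHx']; last first.
  by rewrite clmul_linearl IHx IHx'.
rewrite clmul_base symdiff0 /clsign big1 ?scale1r // => i _.
by rewrite big_set0.
Qed.

Lemma clbase0_neq0 : clbase set0 != 0.
Proof.
by apply/eqP => /ffunP/(_ set0)/eqP; rewrite !ffunE eqxx oner_eq0.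
Qed.

End CliffordProduct.

HB.instance Definition _ (R : realType) (n : nat) :=
  GRing.Zmodule_isNzRing.Build (Cl R n)
    clmulA clmul1r clmulr1 clmulDl clmulDr clbase0_neq0.

Lemma clscaleAl (R : realType) (n : nat) (a : R) (x y : Cl R n) :
  a *: (x * y) = (a *: x) * y.
Proof. by rewrite [RHS]clmulZl. Qed.

HB.instance Definition _ (R : realType) (n : nat) :=
  GRing.Lmodule_isLalgebra.Build R (Cl R n) (@clscaleAl R n).

Lemma clscaleAr (R : realType) (n : nat) (a : R) (x y : Cl R n) :
  a *: (x * y) = x * (a *: y).
Proof. by rewrite [RHS]clmulZr. Qed.

HB.instance Definition _ (R : realType) (n : nat) :=
  GRing.Lalgebra_isAlgebra.Build R (Cl R n) (@clscaleAr R n).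

Section CliffordGenerators.
Context {R : realType} {n : nat}.
Implicit Types (A B : {set 'I_n}) (i j : 'I_n).

Definition clgen i : Cl R n := clbase [set i].

Lemma clbaseM A B :
  clbase A * clbase B = (-1) ^+ clsign A B *: clbase (symdiff A B) :> Cl R n.
Proof. exact: clmul_base. Qed.

Lemma clsign1 i j : clsign [set i] [set j] = (j <= i)%N.
Proof. by rewrite /clsign !big_set1. Qed.

Lemma clgenM i j : (i < j)%N -> clgen i * clgen j = clbase [set i; j].
Proof.
move=> ltij; rewrite clbaseM clsign1 leqNgt ltij scale1r; congr clbase.
apply/setP => k; rewrite !inE; case: (k =P i) => [->|] //=.
by case: eqP ltij => // ->; rewrite ltnn.
Qed.

Lemma clgen_relation i j :
  clgen i * clgen j + clgen j * clgen i = (- (i == j)%:R *+ 2)%:A.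
Proof.
rewrite !clbaseM !clsign1 (symdiffC [set j]) -scalerDl.
have [<-|neij] := eqVneq i j; last first.
  rewrite oppr0 mul0rn scale0r; case: ltngtP => [||/val_inj eij].
  - by rewrite addrC subrr scale0r.
  - by rewrite subrr scale0r.
  - by rewrite eij eqxx in neij.
have -> : symdiff [set i] [set i] = set0.
  by apply/setP => k; rewrite !inE addbb.
by rewrite leqnn.
Qed.

End CliffordGenerators.

Definition lie_bracket (R : realType) (g : lmodType R) (br : g -> g -> g) :=
  [/\ bilinear_for *:%R *:%R br,
      forall x, br x x = 0 &
      forall x y z, br x (br y z) + br y (br z x) + br z (br x y) = 0].

Record lieAlg (R : realType) := LieAlg {
  lie_space :> vectType R;
  lbr : lie_space -> lie_space -> lie_space;
  lbr_axiom : lie_bracket lbr }.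

Section DirectSum.
Variables (R : realType) (g1 g2 : lieAlg R).

Definition lie_dsum_br (x y : g1 * g2) : g1 * g2 :=
  (lbr x.1 y.1, lbr x.2 y.2).

Lemma lie_dsum_axiom : lie_bracket lie_dsum_br.
Proof.
have [[bl1 br1] alt1 jac1] := @lbr_axiom R g1.
have [[bl2 br2] alt2 jac2] := @lbr_axiom R g2.
split=> [|x|x y z]; last 2 first.
- by rewrite /lie_dsum_br alt1 alt2.
- by apply: injective_projections; rewrite /= ?jac1 ?jac2.
by split=> u a x y; apply: injective_projections; rewrite /= ?(bl1, bl2) ?(br1, br2).
Qed.

Definition lie_dsum : lieAlg R := LieAlg lie_dsum_axiom.

End DirectSum.

Lemma lie_u1_axiom (R : realType) :
  lie_bracket (fun _ _ : R^o => 0 : R^o).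
Proof.
split=> [|//|x y z]; last by rewrite !addr0.
by split=> u a x y; rewrite addr0; apply/esym/scaler0.
Qed.

(* t : u(1) stands for t * 'i *)
Definition lie_u1 (R : realType) : lieAlg R := LieAlg (@lie_u1_axiom R).

Section Sp1.
Variable R : realType.
Implicit Types p q r : 'rV[R]_3.

(* q : sp(1) stands for the imaginary quaternion
     q 0 0 * i + q 0 1 * j + q 0 2 * k,
   with bracket the commutator [p, q] = 2 p x q; s + 1 and s + 2 are mod 3. *)
Definition sp1_br p q : 'rV[R]_3 :=
  \row_(s < 3) ((p 0 (s + 1) * q 0 (s + 2) - p 0 (s + 2) * q 0 (s + 1)) *+ 2).

Lemma lie_sp1_axiom : lie_bracket sp1_br.
Proof.
split=> [|p|p q r]; first by split=> u a x y; apply/rowP => s; rewrite !mxE; ring.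
  by apply/rowP => s; rewrite !mxE; ring.
apply/rowP => s; rewrite !mxE.
have s3 : s + 1 + 2 = s by apply/val_inj; case: (s) => -[|[|[|//]]].
have s4 : s + 2 + 1 = s by apply/val_inj; case: (s) => -[|[|[|//]]].
have s5 : s + 1 + 1 = s + 2 by apply/val_inj; case: (s) => -[|[|[|//]]].
have s6 : s + 2 + 2 = s + 1 by apply/val_inj; case: (s) => -[|[|[|//]]].
by rewrite s3 s4 s5 s6; ring.
Qed.

Definition lie_sp1 : lieAlg R := LieAlg lie_sp1_axiom.

End Sp1.

Definition cl_comm (R : realType) (n : nat) (x y : Cl R n) := x * y - y * x.

Section CliffordLie.
Variables (R : realType) (n : nat) (U : {vspace Cl R n}).
Hypothesis commU : {in U &, forall x y, cl_comm x y \in U}.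

Definition cl_sub_br (x y : subvs_of U) : subvs_of U :=
  vsproj U (cl_comm (vsval x) (vsval y)).

Lemma cl_sub_axiom : lie_bracket cl_sub_br.
Proof.
have brK x y : vsval (cl_sub_br x y) = cl_comm (vsval x) (vsval y).
  by rewrite vsprojK // commU ?subvsP.
split=> [|x|x y z]; last 2 first.
- by apply: subvs_inj; rewrite brK /cl_comm subrr linear0.
- apply: subvs_inj; rewrite !linearD linear0 /= !brK /cl_comm.
  move: (vsval x) (vsval y) (vsval z) => {}x {}y {}z.
  rewrite !(mulrBl, mulrBr) !mulrA !opprB.
  have h (p q r s : Cl R n) : p - q + (r - s) = (p + r) - (q + s).
    by rewrite opprD addrACA.
  rewrite (h (x * y * z)) (h (y * z * x)) (h (z * x * y)) (addrC (x * z * y)).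
  rewrite subrKA (addrC (y * x * z)) subrKA.
  by rewrite (addrC (z * y * x)) subrr.
split=> u a x y; apply: subvs_inj; rewrite [RHS]linearP /= !brK linearP /cl_comm.
  by rewrite mulrDl mulrDr scalerBr -scalerAl -scalerAr opprD addrACA.
by rewrite mulrDl mulrDr scalerBr -scalerAl -scalerAr opprD addrACA.
Qed.

Definition lie_cl_sub : lieAlg R := LieAlg cl_sub_axiom.

End CliffordLie.

Section Bivectors.
Context {R : realType} {n : nat}.
Implicit Types (A B : {set 'I_n}) (x y : Cl R n).

(* spin(n), in the even part of Cl_n, under the commutator bracket. *)
Definition bivectors : {vspace Cl R n} :=
  (\sum_(i < n) \sum_(j < n | (i < j)%N) <[clgen i * clgen j]>)%VS.

Lemma bivectors_base A : #|A| = 2 -> clbase A \in bivectors.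
Proof.
move=> /eqP/cards2P[i [j [neij ->]]].
wlog ltij : i j neij / (i < j)%N => [hw|].
  case: (ltngtP i j) => [ltij|gtij|/val_inj eij]; first exact: hw.
    by rewrite setUC; apply: hw; rewrite // eq_sym.
  by rewrite eij eqxx in neij.
rewrite -clgenM //; apply/memv_sumP.
exists (fun k => if k == i then clgen i * clgen j else 0) => [k _|].
  case: eqP => [->|_]; rewrite ?mem0v //; apply/memv_sumP.
  exists (fun l => if l == j then clgen i * clgen j else 0) => [l _|].
    by case: eqP => [->|_]; rewrite ?mem0v ?memv_line.
  by rewrite (bigD1 j) //= eqxx big1 ?addr0 // => l /andP[_ /negbTE->].
by rewrite (bigD1 i) //= eqxx big1 ?addr0 // => l /negbTE->.
Qed.

Lemma bivectors_supp x A : x \in bivectors -> #|A| != 2 -> x A = 0.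
Proof.
move=> /memv_sumP[v vP ->] cA; rewrite sum_ffunE big1 // => i _.
have /memv_sumP[w wP ->] := vP i isT; rewrite sum_ffunE big1 // => j ltij.
have /vlineP[a ->] := wP j ltij; rewrite clgenM // !ffunE.
case: (A =P [set i; j]) cA => [->|_ _]; last by rewrite scaler0.
have neij : i != j by apply: contraTneq ltij => ->; rewrite ltnn.
by rewrite cards2 neij.
Qed.

Lemma bivectorsE x :
  x \in bivectors -> x = \sum_(A : {set 'I_n} | #|A| == 2) x A *: clbase A.
Proof.
move=> xbiv; rewrite [LHS]clbaseE (bigID (fun A : {set _} => #|A| == 2)) /=.
rewrite [X in _ + X]big1 ?addr0 // => A cA.
by rewrite (bivectors_supp xbiv cA) scale0r.
Qed.

Lemma clsign_swap A B :
  (clsign A B + clsign B A = #|A| * #|B| + #|A :&: B|)%N.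
Proof.
have -> : #|A :&: B| = (\sum_(i in A) (i \in B))%N.
  rewrite -sum1_card big_mkcond [RHS]big_mkcond /=; apply: eq_bigr => i _.
  by rewrite inE; do 2!case: (i \in _).
rewrite /clsign [X in (_ + X)%N]exchange_big -sum_nat_const -!big_split /=.
apply: eq_bigr => i _.
have -> : (i \in B) = (\sum_(j in B) (j == i))%N :> nat.
  have [iB|iNB] := boolP (i \in B); last first.
    by rewrite big1 // => j jB; case: eqP iNB jB => // -> /negbTE->.
  by rewrite (bigD1 i) //= eqxx big1 // => j /andP[_ /negbTE->].
rewrite -sum1_card -!big_split /=; apply: eq_bigr => j _.
by rewrite -(inj_eq val_inj) /=; case: ltngtP.
Qed.

Lemma card_symdiff A B : (#|symdiff A B| + #|A :&: B| * 2 = #|A| + #|B|)%N.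
Proof.
rewrite -[#|A|]sum1_card -[#|B|]sum1_card -[#|_ :&: _|]sum1_card -sum1_card.
rewrite !(big_mkcond (fun i => i \in _)) big_distrl -!big_split /=.
by apply: eq_bigr => i _; rewrite !inE; do 2!case: (i \in _).
Qed.

Lemma bivectors_comm : {in bivectors &, forall x y, cl_comm x y \in bivectors}.
Proof.
move=> x y /bivectorsE-> /bivectorsE->; rewrite /cl_comm.
rewrite !mulr_suml (eq_bigr _ (fun i _ => mulr_sumr _ _ _ _)) /=.
rewrite (eq_bigr _ (fun i _ => mulr_sumr _ _ _ _)) [X in _ - X]exchange_big /=.
rewrite -sumrB; apply: rpred_sum => A /eqP cA.
rewrite -sumrB; apply: rpred_sum => B /eqP cB.
rewrite -!scalerAl -!scalerAr !scalerA (mulrC (y B)) -scalerBr; apply: rpredZ.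
rewrite !clbaseM (symdiffC B) -scalerBl.
rewrite -[in X in X - _]signr_odd -[in X in _ - X]signr_odd.
have := congr1 odd (clsign_swap A B); rewrite cA cB oddD oddD /=.
have [oddI|evenI] := boolP (odd #|A :&: B|); last first.
  by case: (odd _); case: (odd _); rewrite // subrr scale0r mem0v.
move=> _; apply/rpredZ/bivectors_base.
have := card_symdiff A B; rewrite cA cB.
have := subset_leq_card (subsetIl A B); rewrite cA.
by case: #|A :&: B| oddI => [|[|[|]]] //= _ _ /eqP; rewrite (eqn_add2r 2 _ 2) => /eqP.
Qed.

End Bivectors.

Section EvenPart.
Context {R : realType} {n : nat}.
Implicit Types (A B : {set 'I_n}) (C : {set 'I_n.+1}) (x y : Cl R n).

(* The isomorphism of Cl_n with the even part of Cl_(n+1) that maps e_i to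
   e_i * e_n, n = ord_max being the last index (see even_map_gen, even_mapM,
   even_map_inj and even_mapP). As (e_i e_n) * (e_j e_n) = e_i e_j for i != j,
   it maps e_A to e_A if #|A| is even, and to e_A * e_n otherwise. *)
Definition even_map x : Cl R n.+1 :=
  [ffun C : {set 'I_n.+1} => if odd #|C| then 0 else x (lift ord_max @^-1: C)].

Definition even_set A : {set 'I_n.+1} :=
  [set i | if unlift ord_max i is Some j then j \in A else odd #|A|].

Lemma even_set_lift A i : (lift ord_max i \in even_set A) = (i \in A).
Proof. by rewrite inE liftK. Qed.

Lemma even_set_max A : (ord_max \in even_set A) = odd #|A|.
Proof. by rewrite inE unlift_none. Qed.

Lemma even_setK A : lift ord_max @^-1: even_set A = A.
Proof. by apply/setP => i; rewrite inE even_set_lift. Qed.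

Lemma sum_ord_lift (F : 'I_n.+1 -> nat) :
  (\sum_i F i = \sum_(i < n) F (lift ord_max i) + F ord_max)%N.
Proof.
rewrite big_ord_recr /=; congr (_ + _)%N; apply: eq_bigr => i _.
by congr F; apply/val_inj; exact/esym/lift_max.
Qed.

Lemma card_lift C : #|C| = (#|lift ord_max @^-1: C| + (ord_max \in C))%N.
Proof.
rewrite -!sum1_card !(big_mkcond (fun i => i \in _)) sum_ord_lift /=.
congr (_ + _)%N; first by apply: eq_bigr => i _; rewrite inE.
Qed.

Lemma odd_even_set A : odd #|even_set A| = false.
Proof. by rewrite card_lift even_setK even_set_max oddD oddb addbb. Qed.

Lemma even_setE C : ~~ odd #|C| -> even_set (lift ord_max @^-1: C) = C.
Proof.
move=> evenC; apply/setP => i; case: (unliftP ord_max i) => [j|] ->.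
  by rewrite even_set_lift inE.
by move: evenC; rewrite even_set_max card_lift oddD oddb negb_add => /eqP.
Qed.

Lemma even_map_base A : even_map (clbase A) = clbase (even_set A).
Proof.
apply/ffunP => C; rewrite !ffunE; case: ifPn => oddC.
  by case: eqP oddC => // ->; rewrite odd_even_set.
congr (nat_of_bool _)%:R; apply/eqP/eqP => [<-|->]; last by rewrite even_setK.
by rewrite even_setE.
Qed.

Lemma even_map_linear : linear even_map.
Proof.
move=> a x y; apply/ffunP => C; rewrite !ffunE.
by case: ifP; rewrite // scaler0 addr0.
Qed.

HB.instance Definition _ :=
  GRing.isLinear.Build R (Cl R n) (Cl R n.+1) _ even_map even_map_linear.

Lemma even_set_symdiff A B :
  even_set (symdiff A B) = symdiff (even_set A) (even_set B).
Proof.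
apply/setP => i; case: (unliftP ord_max i) => [j|] ->.
  by rewrite [RHS]inE !even_set_lift inE.
rewrite [RHS]inE !even_set_max -oddD -card_symdiff oddD muln2 odd_double.
by rewrite addbF.
Qed.

Lemma clsignE (m : nat) (A B : {set 'I_m}) : clsign A B =
  (\sum_i \sum_j ((i \in A) && (j \in B) && (j <= i)%N))%N.
Proof.
rewrite /clsign big_mkcond; apply: eq_bigr => i _.
case: (i \in A); last by rewrite big1.
by rewrite big_mkcond; apply: eq_bigr => j _ /=; case: (j \in B).
Qed.

Lemma odd_clsign_even A B :
  odd (clsign (even_set A) (even_set B)) = odd (clsign A B).
Proof.
have lt_lift (i : 'I_n) : (lift ord_max i < n)%N.
  by rewrite lift_max.
rewrite !clsignE sum_ord_lift oddD -[RHS]addbF; congr (_ (+) _).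
  congr odd; apply: eq_bigr => i _; rewrite sum_ord_lift.
  rewrite [X in (_ + X)%N]/= leqNgt lt_lift andbF addn0.
  apply: eq_bigr => j _; rewrite !even_set_lift.
  by rewrite !lift_max.
rewrite sum_ord_lift !even_set_max leqnn andbT.
case oddA: (odd #|A|); last by rewrite big1.
rewrite (eq_bigr (fun j => (j \in B) : nat)) => [|j _]; last first.
  by rewrite even_set_lift (ltnW (lt_lift j)) andbT.
have -> : (\sum_(j < n) (j \in B) = #|B|)%N.
  by rewrite -sum1_card [RHS]big_mkcond; apply: eq_bigr => j _; case: (_ \in _).
by rewrite oddD oddb addbb.
Qed.

Lemma even_map1 : even_map 1 = 1.
Proof.
rewrite even_map_base; congr clbase; apply/setP => i.
by case: (unliftP ord_max i) => [j|] ->;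
   rewrite ?even_set_lift ?even_set_max ?cards0 !inE.
Qed.

Lemma even_mapM x y : even_map (x * y) = even_map x * even_map y.
Proof.
elim/(@clbase_ind R n): x => [A|a x x' IHx IHx']; last first.
  by rewrite mulrDl -scalerAl !even_map_linear IHx IHx' mulrDl scalerAl.
elim/(@clbase_ind R n): y => [B|a y y' IHy IHy']; last first.
  by rewrite mulrDr -scalerAr !even_map_linear IHy IHy' mulrDr scalerAr.
rewrite clbaseM linearZ /= !even_map_base clbaseM even_set_symdiff.
by rewrite -signr_odd -[in RHS]signr_odd odd_clsign_even.
Qed.

Lemma even_map_gen i :
  even_map (clgen i) = clgen (lift ord_max i) * clgen ord_max.
Proof.
rewrite clgenM; last by rewrite lift_max.
rewrite even_map_base; congr clbase; apply/setP => k.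
case: (unliftP ord_max k) => [j|] ->.
  rewrite even_set_lift !inE (inj_eq lift_inj) [X in _ || X]eq_sym.
  by rewrite (negbTE (neq_lift _ _)) orbF.
by rewrite even_set_max cards1 !inE eqxx orbT.
Qed.

Lemma even_map_inj : injective even_map.
Proof.
move=> x y /ffunP eqxy; apply/ffunP => A.
by have := eqxy (even_set A); rewrite !ffunE odd_even_set even_setK.
Qed.

Lemma even_mapP (y : Cl R n.+1) :
  (exists x, y = even_map x) <-> (forall C, odd #|C| -> y C = 0).
Proof.
split=> [[x ->] C oddC|y0]; first by rewrite ffunE oddC.
exists [ffun A => y (even_set A)]; apply/ffunP => C; rewrite !ffunE.
by case: ifPn => [/y0//|evenC]; rewrite even_setE.
Qed.

End EvenPart.

Section Spin.
Variables (R : realType) (n : nat).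

(* spin(n) inside Cl_(n-1), through the isomorphism of Cl_(n-1) with the even
   part of Cl_n; n.-1.+1 is n only for n > 0. *)
Definition spin_space : {vspace Cl R n.-1} :=
  (linfun even_map @^-1: bivectors)%VS.

Lemma spin_comm : {in spin_space &, forall x y, cl_comm x y \in spin_space}.
Proof.
move=> x y; rewrite -!memv_preim !lfunE => xb yb.
by rewrite /= /cl_comm linearB /= !even_mapM bivectors_comm.
Qed.

Definition lie_spin : lieAlg R := lie_cl_sub spin_comm.

End Spin.

Section Representations.
Variables (R : realType) (L : Type).

Definition irreducible_rep (V : vectType R) (rho : L -> V -> V) :=
  (fullv : {vspace V}) <> 0%VS /\
  forall U : {vspace V},
    (forall a v, v \in U -> rho a v \in U) -> U = 0%VS \/ U = fullv.

Definition equivalent_rep (V V' : vectType R)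
    (rho : L -> V -> V) (rho' : L -> V' -> V') :=
  exists f : 'Hom(V, V'),
    bijective f /\ forall a v, f (rho a v) = rho' a (f v).

Definition rep_dsum (V V' : vectType R)
    (rho : L -> V -> V) (rho' : L -> V' -> V') (a : L) (v : V * V') : V * V' :=
  (rho a v.1, rho' a v.2).

End Representations.

Definition algebra_rep (R : realType) (A : algType R) (V : vectType R)
    (c : A -> V -> V) :=
  [/\ bilinear_for *:%R *:%R c,
      forall v, c 1 v = v &
      forall x y v, c (x * y) v = c x (c y v)].

Definition irreducible_algebra_rep (R : realType) (A : algType R)
    (V : vectType R) (c : A -> V -> V) :=
  algebra_rep c /\ irreducible_rep c.

Definition clifford_rep (R : realType) (n : nat) (V : vectType R)
    (c : Cl R n -> V -> V) :=
  if (n %% 4 == 3)%N then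
    algebra_rep c /\
    exists (V1 V2 : vectType R) (c1 : Cl R n -> V1 -> V1)
           (c2 : Cl R n -> V2 -> V2),
      [/\ irreducible_algebra_rep c1, irreducible_algebra_rep c2,
          ~ equivalent_rep c1 c2 & equivalent_rep c (rep_dsum c1 c2)]
  else irreducible_algebra_rep c.

Definition spinor_rep (R : realType) (n : nat) (V : vectType R)
    (sigma : lie_spin R n -> V -> V) :=
  exists2 c : Cl R n.-1 -> V -> V,
    clifford_rep c & forall a v, sigma a v = c (vsval a) v.

(* Sigma_n^(+). When 4 divides n, sigma can be either of the two irreducible
   summands of Sigma_n: which of them is called Sigma_n^+ depends only on a
   choice of orientation. *)
Definition plus_spinor_rep (R : realType) (n : nat) (V : vectType R)
    (sigma : lie_spin R n -> V -> V) :=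
  if (n %% 4 == 0)%N then
    irreducible_rep sigma /\
    exists (V' W : vectType R) (sigma' : lie_spin R n -> V' -> V')
           (tau : lie_spin R n -> W -> W),
      [/\ irreducible_rep sigma', spinor_rep tau &
          equivalent_rep tau (rep_dsum sigma sigma')]
  else spinor_rep sigma.

Inductive rep_type := RealType | ComplexType | QuaternionicType.

Definition spinor_type (n : nat) : rep_type :=
  if (n %% 8)%N \in [:: 0; 1; 7]%N then RealType
  else if (n %% 8)%N \in [:: 2; 6]%N then ComplexType
  else QuaternionicType.

Definition spin_ext (R : realType) (n : nat) (t : rep_type) : lieAlg R :=
  match t with
  | RealType => lie_spin R n
  | ComplexType => lie_dsum (lie_spin R n) (lie_u1 R)
  | QuaternionicType => lie_dsum (lie_spin R n) (lie_sp1 R)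
  end.

Definition spin_tilde (R : realType) (n : nat) : lieAlg R :=
  spin_ext R n (spinor_type n).

Section SpinTildeAction.
Variables (R : realType) (n : nat) (V : vectType R).
Variable sigma : lie_spin R n -> V -> V.

Definition in_commutant (J : 'End(V)) :=
  forall a v, J (sigma a v) = sigma a (J v).

Definition complex_structure (J : 'End(V)) :=
  in_commutant J /\ forall v, J (J v) = - v.

Definition quaternionic_structure (I J : 'End(V)) :=
  [/\ complex_structure I, complex_structure J &
      forall v, I (J v) = - J (I v)].

Definition spin_ext_action (t : rep_type) :
    (spin_ext R n t -> V -> V) -> Prop :=
  match t with
  | RealType => fun rho => forall a v, rho a v = sigma a v
  | ComplexType => fun rho =>
      exists2 J : 'End(V), complex_structure J &
        forall a (z : R) v, rho (a, z) v = sigma a v + z *: J v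
  | QuaternionicType => fun rho =>
      exists I J : 'End(V), quaternionic_structure I J /\
        forall a (q : 'rV[R]_3) v, rho (a, q) v =
          sigma a v + (q 0 0 *: I v + q 0 1 *: J v + q 0 2 *: I (J v))
  end.

Definition spin_tilde_action (rho : spin_tilde R n -> V -> V) :=
  spin_ext_action rho.

End SpinTildeAction.

(* That h is of compact type is part of the existence of Bh. *)
Definition of_lie_type (R : realType) (h : lieAlg R) (m : vectType R)
    (rho : h -> m -> m) :=
  exists (Bh : {dot h for idfun}) (Bm : {dot m for idfun})
         (br : h * m -> h * m -> h * m),
  [/\ forall a b c : h, Bh (lbr a b) c + Bh b (lbr a c) = 0,
      forall (a : h) (v w : m), Bm (rho a v) w + Bm v (rho a w) = 0 &
      lie_bracket br] /\
  [/\ forall a b : h, br (a, 0) (b, 0) = (lbr a b, 0),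
      forall (a : h) (v : m), br (a, 0) (0, v) = (0, rho a v),
      forall (a : h) (v : m), br (0, v) (a, 0) = (0, - rho a v) &
      forall (a : h) (v w : m), Bh a (br (0, v) (0, w)).1 = Bm (rho a v) w].

(* Main.v *)
From HB Require Import structures.
Require Import Defs.
From mathcomp Require Import all_boot all_order all_algebra.
From mathcomp Require Import boolp reals ring lra zify.

(* Let N be the dimension of the representation m. As e_1 e_2 acts on m as a
   complex structure, the m-component T of the bracket of m satisfies
   T(v, w) = 2 T(Jv, Jw) = 4 T(v, w), so [m, m] is contained in h. Given the
   invariant products, the bracket is then determined by condition (3), and the
   Jacobi identity amounts to the vanishing of the 4-form
     Omega = \sum_i w_i a_i /\ a_i,
   where (a_i) is the basis of h formed of the e_i e_j and of the structures in
   the commutant, and w_i is the inverse squared norm of a_i. The a_i square to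
   -1 and commute or anticommute pairwise; let chi_ij be the sign of a_i a_j =
   chi_ij a_j a_i. All traces being known, the contraction of Omega with
   a_j /\ a_j is, up to a positive factor,
     N w_j - 2 \sum_i w_i chi_ij,
   and |Omega|^2 is a positive combination of these numbers: Omega vanishes if
   they do, and even if they are all nonpositive.
   With d = (n - 4)^2 - n, with k = 0, 1 or 3 the dimension of the imaginary part
   of the commutant, and with weights l on spin(n) and u on the other summand,
   their vanishing reads
     N l = d l + 2 k u   and   u (N + 2 k - 4) = l n (n - 1).
   As N^2 >= 2^(2 floor((n - 1) / 2)), these equations have no solution if n is
   7, 11, 13, 14, 15 or at least 17. In the remaining cases an upper bound of N
   is enough: N is at most 2^(n - 1 - s) if there are s independent commuting
   e_A with square 1, and such families come from doubly even codes of
   length n. *)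

Set Implicit Arguments.
Unset Strict Implicit.
Unset Printing Implicit Defensive.

Import Order.TTheory GRing.Theory Num.Theory.

(** * The four-form of a family of skew matrices *)

Section FourForm.
Local Open Scope ring_scope.
Variables (R : realFieldType) (N : nat) (I : finType).
Variables (a : I -> 'M[R]_N) (w : I -> R).

(** Up to a constant factor, the coefficients of \sum_i w_i a_i /\ a_i for skew a_i: the three terms
    rotate p, q, r and keep s fixed. *)
Definition four_form p q r s : R :=
  \sum_i w i * (a i p q * a i r s + a i q r * a i p s + a i r p * a i q s).

Lemma four_form_cyc p q r s : four_form q r p s = four_form p q r s.
Proof. by apply: eq_bigr => i _; congr (_ * _); ring. Qed.

Lemma trmx_mul4 (A B C D : 'M[R]_N) :
  \tr (A *m B *m C *m D) =
  \sum_p \sum_q \sum_r \sum_s A p q * B q r * C r s * D s p.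
Proof.
apply: eq_bigr => p _; rewrite mxE.
under eq_bigr => s _.
  rewrite mxE mulr_suml.
  under eq_bigr => r _ do rewrite mxE !mulr_suml.
  rewrite exchange_big.
  over.
by rewrite exchange_big; apply: eq_bigr => q _; rewrite exchange_big.
Qed.

Lemma trmx_mul2 (A B : 'M[R]_N) : \tr (A *m B) = \sum_p \sum_q A p q * B q p.
Proof. by apply: eq_bigr => p _; rewrite mxE. Qed.

Hypothesis a_skew : forall i p q, a i q p = - a i p q.

Lemma sum4D (F G : 'I_N -> 'I_N -> 'I_N -> 'I_N -> R) :
  \sum_p \sum_q \sum_r \sum_s (F p q r s + G p q r s) =
  \sum_p \sum_q \sum_r \sum_s F p q r s + \sum_p \sum_q \sum_r \sum_s G p q r s.
Proof.
rewrite -big_split; apply: eq_bigr => p _; rewrite -big_split.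
apply: eq_bigr => q _; rewrite -big_split; apply: eq_bigr => r _.
by rewrite -big_split.
Qed.

Lemma sum4Z c (F : 'I_N -> 'I_N -> 'I_N -> 'I_N -> R) :
  \sum_p \sum_q \sum_r \sum_s (c * F p q r s) =
  c * \sum_p \sum_q \sum_r \sum_s F p q r s.
Proof.
rewrite mulr_sumr; apply: eq_bigr => p _; rewrite mulr_sumr.
apply: eq_bigr => q _; rewrite mulr_sumr; apply: eq_bigr => r _.
by rewrite mulr_sumr.
Qed.

Lemma sum4_exchange (J : finType) (F : J -> 'I_N -> 'I_N -> 'I_N -> 'I_N -> R) :
  \sum_p \sum_q \sum_r \sum_s \sum_j F j p q r s =
  \sum_j \sum_p \sum_q \sum_r \sum_s F j p q r s.
Proof.
rewrite [RHS]exchange_big; apply: eq_bigr => p _.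
rewrite [RHS]exchange_big; apply: eq_bigr => q _.
rewrite [RHS]exchange_big; apply: eq_bigr => r _.
by rewrite [RHS]exchange_big.
Qed.

Lemma eq_sum4 (F G : 'I_N -> 'I_N -> 'I_N -> 'I_N -> R) :
  (forall p q r s, F p q r s = G p q r s) ->
  \sum_p \sum_q \sum_r \sum_s F p q r s = \sum_p \sum_q \sum_r \sum_s G p q r s.
Proof.
by move=> FG; do 4![apply: eq_bigr => ? _].
Qed.

Lemma sum4_cyc (F : 'I_N -> 'I_N -> 'I_N -> 'I_N -> R) :
  \sum_p \sum_q \sum_r \sum_s F q r p s = \sum_p \sum_q \sum_r \sum_s F p q r s.
Proof.
rewrite exchange_big; apply: eq_bigr => q _.
by rewrite exchange_big.
Qed.

(** By skewness, the first term of [four_form] splits over (p, q) and (r, s) into a product of two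
    traces, and each of the other two is minus a sum over closed walks p, q, r, s that is the trace
    of a_i a_j a_i a_j. *)
Lemma four_form_contract j :
  \sum_p \sum_q \sum_r \sum_s a j p q * a j r s * four_form p q r s =
  \sum_i w i * (\tr (a j *m a i) ^+ 2 - \tr (a i *m a j *m a i *m a j) *+ 2).
Proof.
under eq_sum4 => p q r s do rewrite /four_form mulr_sumr.
rewrite sum4_exchange; apply: eq_bigr => i _.
have E p q r s : a j p q * a j r s *
    (w i * (a i p q * a i r s + a i q r * a i p s + a i r p * a i q s)) =
  w i * ((a j p q * a i q p) * (a j r s * a i s r)
         + - (a j p q * a i q r * a j r s * a i s p)
         + - (a i r p * a j p q * a i q s * a j s r)).
  by rewrite (a_skew i p q) (a_skew i r s) (a_skew i p s) (a_skew j r s); ring.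
under eq_sum4 => p q r s do rewrite E.
rewrite sum4Z !sum4D; congr (_ * _).
rewrite mulr2n opprD addrA; congr (_ + _ + _).
- rewrite expr2 trmx_mul2 mulr_suml; apply: eq_bigr => p _.
  rewrite mulr_suml; apply: eq_bigr => q _.
  rewrite mulr_sumr; apply: eq_bigr => r _.
  by rewrite mulr_sumr.
- rewrite -!mulmxA mxtrace_mulC !mulmxA trmx_mul4.
  by do 4![rewrite -sumrN; apply: eq_bigr => ? _].
(* The third term visits the indices in the order r, p, q, s; two rotations of p, q, r bring it to
   the order of the trace. *)
- pose H p q r s := a i p q * a j q r * a i r s * a j s p.
  rewrite trmx_mul4 -(sum4_cyc H) -(sum4_cyc (fun p q r s => H q r p s)).
  by do 4![rewrite -sumrN; apply: eq_bigr => ? _].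
Qed.

(** Expanding one factor of each square gives three sums, which are equal because [four_form] is
    invariant under rotation of p, q, r; each is a weighted sum of the contractions above. *)
Lemma four_form_norm :
  \sum_p \sum_q \sum_r \sum_s four_form p q r s ^+ 2 =
  (\sum_j w j * \sum_i w i *
    (\tr (a j *m a i) ^+ 2 - \tr (a i *m a j *m a i *m a j) *+ 2)) *+ 3.
Proof.
under [in RHS]eq_bigr => j _ do rewrite -four_form_contract.
have E p q r s : four_form p q r s ^+ 2 =
  \sum_j w j * (a j p q * a j r s * four_form p q r s
    + a j q r * a j p s * four_form q r p s
    + a j r p * a j q s * four_form r p q s).
  rewrite (four_form_cyc p q r s) -(four_form_cyc r p q s) expr2.
  rewrite [X in X * _]/four_form mulr_suml.
  by apply: eq_bigr => j _; ring.
under eq_sum4 => p q r s do rewrite E.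
rewrite sum4_exchange -sumrMnl; apply: eq_bigr => j _.
rewrite sum4Z !sum4D -mulrnAr; congr (_ * _).
set G := fun p q r s => a j p q * a j r s * four_form p q r s.
rewrite -[_ *+ 3]/(_ + (_ + _)) addrA.
congr (_ + _ + _); first exact: (sum4_cyc G).
exact: etrans (sum4_cyc (fun p q r s => G q r p s)) (sum4_cyc G).
Qed.

Lemma four_form_eq0 :
  \sum_j w j * \sum_i w i *
    (\tr (a j *m a i) ^+ 2 - \tr (a i *m a j *m a i *m a j) *+ 2) <= 0 ->
  forall p q r s, four_form p q r s = 0.
Proof.
move=> le0 p q r s.
have sq_ge0 p' q' r' s' : 0 <= four_form p' q' r' s' ^+ 2 by apply: sqr_ge0.
have : \sum_p \sum_q \sum_r \sum_s four_form p q r s ^+ 2 == 0.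
  rewrite eq_le four_form_norm mulrn_wle0 //= -four_form_norm.
  by do 4![apply: sumr_ge0 => ? _].
rewrite psumr_eq0 => [/allP/(_ p)|? _]; last by do 3![apply: sumr_ge0 => ? _].
rewrite mem_index_enum => /(_ isT)/=.
rewrite psumr_eq0 => [/allP/(_ q)|? _]; last by do 2![apply: sumr_ge0 => ? _].
rewrite mem_index_enum => /(_ isT)/=.
rewrite psumr_eq0 => [/allP/(_ r)|? _]; last by apply: sumr_ge0 => ? _.
rewrite mem_index_enum => /(_ isT)/=.
rewrite psumr_eq0 => [/allP/(_ s)|? _]; last by [].
by rewrite mem_index_enum => /(_ isT)/=; rewrite sqrf_eq0 => /eqP.
Qed.

End FourForm.

(** * Traces of products of anticommuting complex structures *)

Section AnticommutingTraces.
Local Open Scope ring_scope.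
Variables (R : realFieldType) (N : nat).
Implicit Types (x y : 'M[R]_N).

(** The trace of y x y is - \tr x by cyclicity, and \tr x because x and y anticommute. *)
Lemma mxtrace_anticomm x y :
  y *m y = - 1%:M -> x *m y = - (y *m x) -> \tr x = 0.
Proof.
move=> yy xy.
have : \tr (y *m x *m y) = - \tr x.
  by rewrite mxtrace_mulC mulmxA yy mulNmx mul1mx raddfN.
have -> : y *m x *m y = x by rewrite -mulmxA xy mulmxN mulmxA yy mulNmx mul1mx opprK.
lra.
Qed.

Variables (I : finType) (a : I -> 'M[R]_N) (anti : rel I) (w : I -> R).
Hypothesis a_sqr : forall i, a i *m a i = - 1%:M.
Hypothesis a_comm : forall i j, a i *m a j = (-1) ^+ anti i j *: (a j *m a i).
Hypothesis anti_sep :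
  forall i j, i != j -> exists l, anti l i (+) anti l j.

(** For i != j, the separating a_l anticommutes with the product a_i a_j, whose trace therefore
    vanishes. *)
Lemma mxtrace_clifford2 i j : \tr (a i *m a j) = - (N%:R * (i == j)%:R).
Proof.
have [->|neij] := eqVneq i j; first by rewrite a_sqr raddfN /= mxtrace1 mulr1.
rewrite mulr0 oppr0; have [l sep] := anti_sep neij.
apply: (mxtrace_anticomm (a_sqr l)).
rewrite mulmxA (a_comm l i) -scalemxAl -(mulmxA (a i) (a l)) (a_comm l j).
rewrite -scalemxAr scalerA mulmxA -signr_addb sep scaleN1r opprK //.
Qed.

Lemma mxtrace_clifford4 i j :
  \tr (a i *m a j *m a i *m a j) = (-1) ^+ anti i j * N%:R.
Proof.
rewrite (a_comm i j) -!scalemxAl -(mulmxA (a j)) a_sqr mulmxN mulmx1 mulNmx.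
by rewrite a_sqr opprK mxtraceZ mxtrace1.
Qed.

Definition clifford_excess j : R :=
  w j * N%:R - (\sum_i w i * (-1) ^+ anti i j) *+ 2.

Lemma four_form_contract_clifford j :
  \sum_i w i *
    (\tr (a j *m a i) ^+ 2 - \tr (a i *m a j *m a i *m a j) *+ 2) =
  N%:R * clifford_excess j.
Proof.
under eq_bigr => i _ do rewrite mulrBr mulrnAr mxtrace_clifford4.
rewrite sumrB sumrMnl /clifford_excess mulrBr; congr (_ - _).
  rewrite (bigD1 j) //= mxtrace_clifford2 eqxx mulr1 big1 => [|i neij]; first by ring.
  by rewrite mxtrace_clifford2 eq_sym (negbTE neij) mulr0 oppr0 expr0n mulr0.
rewrite mulrnAr; congr (_ *+ 2); rewrite mulr_sumr.
by apply: eq_bigr => i _; ring.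
Qed.

End AnticommutingTraces.

Section LinearMaps.
Local Open Scope ring_scope.
Variables (R : nzRingType) (U W : lmodType R) (F : U -> W).
Hypothesis linF : linear F.

Lemma lin0 : F 0 = 0.
Proof. by have := linF (-1) 0 0; rewrite scaler0 addr0 scaleN1r addNr. Qed.

Lemma linD u v : F (u + v) = F u + F v.
Proof. by have := linF 1 u v; rewrite !scale1r. Qed.

Lemma linZ a u : F (a *: u) = a *: F u.
Proof. by rewrite -[_ *: u]addr0 linF lin0 addr0. Qed.

Lemma linN u : F (- u) = - F u.
Proof. by rewrite -scaleN1r linZ scaleN1r. Qed.

Lemma linB u v : F (u - v) = F u - F v.
Proof. by rewrite linD linN. Qed.

Lemma lin_sum (J : Type) (s : seq J) (P : pred J) (G : J -> U) :
  F (\sum_(j <- s | P j) G j) = \sum_(j <- s | P j) F (G j).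
Proof. exact: (big_morph F linD lin0). Qed.

End LinearMaps.

(** * Dot products *)

Section DotProducts.
Local Open Scope ring_scope.
Variables (R : realType) (V : vectType R).

(** Dot products as bare functions, which can be given by formulas; [dot_is_dot] and [bundle_dot]
    translate from and to the bundled type used in the statement. *)
Record is_dot (B : V -> V -> R) : Prop := IsDot {
  is_dot_linear : forall w a u v, B (a *: u + v) w = a * B u w + B v w;
  is_dotC : forall u v, B u v = B v u;
  is_dot_gt0 : forall u, u != 0 -> 0 < B u u }.

Lemma dot_is_dot (B : {dot V for idfun}) : is_dot B.
Proof.
split=> [w a u v|u v|u u0]; first by rewrite linearPl.
  by rewrite [LHS]hermitian_subproof expr0 mul1r.
exact: neq0_dnorm_gt0.
Qed.

Definition form_of (B : V -> V -> R) of is_dot B := B.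

Section Bundle.
Variable B : V -> V -> R.
Hypothesis Bdot : is_dot B.

Lemma form_of_bilinear : bilinear_for *%R (idfun \; *%R) (form_of Bdot).
Proof.
have [Bl Bs _] := Bdot.
split=> [w a u v|w a u v]; first exact: Bl.
by rewrite /form_of Bs Bl (Bs u) (Bs v).
Qed.

HB.instance Definition _ :=
  bilinear_isBilinear.Build R V V R _ _ (form_of Bdot) form_of_bilinear.

Lemma form_of_herm x y :
  form_of Bdot x y = (-1) ^+ false * idfun (form_of Bdot y x).
Proof. by rewrite mul1r; apply: is_dotC. Qed.

HB.instance Definition _ :=
  isHermitianSesquilinear.Build R V false idfun (form_of Bdot) form_of_herm.

HB.instance Definition _ :=
  isDotProduct.Build R V (form_of Bdot) (is_dot_gt0 Bdot).

Definition bundle_dot : {dot V for idfun} := form_of Bdot.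

Lemma bundle_dotE u v : bundle_dot u v = B u v.
Proof. by []. Qed.

End Bundle.

Section Theory.
Variable B : V -> V -> R.
Hypothesis Bdot : is_dot B.

Lemma dotDl w u v : B (u + v) w = B u w + B v w.
Proof. by rewrite -[u]scale1r is_dot_linear // scale1r mul1r. Qed.

Lemma dot0l w : B 0 w = 0.
Proof. by have := dotDl w 0 0; rewrite addr0; lra. Qed.

Lemma dotZl w a u : B (a *: u) w = a * B u w.
Proof. by rewrite -[_ *: _]addr0 is_dot_linear // dot0l addr0. Qed.

Lemma dotDr w u v : B w (u + v) = B w u + B w v.
Proof. by rewrite !(is_dotC Bdot w) dotDl. Qed.

Lemma dotZr w a u : B w (a *: u) = a * B w u.
Proof. by rewrite !(is_dotC Bdot w) dotZl. Qed.

Lemma dotNl w u : B (- u) w = - B u w.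
Proof. by rewrite -scaleN1r dotZl mulN1r. Qed.

Lemma dotNr w u : B w (- u) = - B w u.
Proof. by rewrite -scaleN1r dotZr mulN1r. Qed.

Lemma dot_suml (J : Type) (s : seq J) (P : pred J) (F : J -> V) w :
  B (\sum_(j <- s | P j) F j) w = \sum_(j <- s | P j) B (F j) w.
Proof. by apply: (big_morph (B^~ w) (dotDl w) (dot0l w)). Qed.

Lemma dot_sumr (J : Type) (s : seq J) (P : pred J) (F : J -> V) w :
  B w (\sum_(j <- s | P j) F j) = \sum_(j <- s | P j) B w (F j).
Proof. by rewrite is_dotC // dot_suml; apply: eq_bigr => j _; rewrite is_dotC. Qed.

Lemma dot_ge0 u : 0 <= B u u.
Proof.
by have [->|u0] := eqVneq u 0; [rewrite dot0l|apply/ltW/is_dot_gt0].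
Qed.

Lemma dot_inj u v : (forall w, B u w = B v w) -> u = v.
Proof.
move=> uv; apply/eqP; rewrite -subr_eq0; apply/negPn/negP => /(is_dot_gt0 Bdot).
by rewrite dotDl dotNl uv subrr ltxx.
Qed.

Definition orthonormal_family k (f : 'I_k -> V) :=
  forall p q, B (f p) (f q) = (p == q)%:R.

Lemma orthonormal_le_dim k (f : 'I_k -> V) :
  orthonormal_family f -> (k <= \dim {:V})%N.
Proof.
move=> fo; pose s := [tuple f p | p < k].
have /eqP fs : free s.
  apply/freeP => c c0 p; have := congr1 (B^~ (f p)) c0.
  rewrite dot0l dot_suml (bigD1 p) //= big1 => [|q neqp].
    by rewrite nth_mktuple dotZl fo eqxx mulr1 addr0.
  by rewrite nth_mktuple dotZl fo (negbTE neqp) mulr0.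
by rewrite -(size_tuple s) -fs dimvS ?subvf.
Qed.

(** A Gram-Schmidt step: v minus its projection is orthogonal to the family and, once normalized, is
    appended at the last index. *)
Lemma orthonormal_extend k (f : 'I_k -> V) v :
  orthonormal_family f -> v != \sum_p B v (f p) *: f p ->
  exists g : 'I_k.+1 -> V, orthonormal_family g.
Proof.
move=> fo; rewrite -subr_eq0; set u := _ - _ => u0.
have uf q : B u (f q) = 0.
  rewrite dotDl dotNl dot_suml (bigD1 q) //= big1 => [|p nepq].
    by rewrite dotZl fo eqxx mulr1 addr0 subrr.
  by rewrite dotZl fo (negbTE nepq) mulr0.
have Bu := is_dot_gt0 Bdot u0.
have su0 : Num.sqrt (B u u) != 0 by rewrite gt_eqF // sqrtr_gt0.
pose u1 := (Num.sqrt (B u u))^-1 *: u.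
exists (fun p => if unlift ord_max p is Some q then f q else u1) => p q.
case: (unliftP ord_max p) => [p'|] ->; case: (unliftP ord_max q) => [q'|] ->;
  rewrite ?liftK ?unlift_none.
- by rewrite fo (inj_eq lift_inj).
- by rewrite dotZr is_dotC // uf mulr0 eq_sym (negbTE (neq_lift _ _)).
- by rewrite dotZl uf mulr0 (negbTE (neq_lift _ _)).
rewrite dotZr dotZl eqxx mulrA -invfM -expr2 sqr_sqrtr ?mulVf ?gt_eqF //.
exact: ltW.
Qed.

Lemma orthonormal_basis : exists f : 'I_(\dim {:V}) -> V,
  orthonormal_family f /\ forall v, v = \sum_p B v (f p) *: f p.
Proof.
have [k [f [fo fc]]] : exists k, exists f : 'I_k -> V,
    orthonormal_family f /\ forall v, v = \sum_p B v (f p) *: f p.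
  (* Induction on a bound d of the codimension: a family that misses a vector can be extended, and
     [orthonormal_le_dim] stops the process. *)
  suff H d : forall k (f : 'I_k -> V), orthonormal_family f ->
      (\dim {:V} - k <= d)%N -> exists k, exists f : 'I_k -> V,
      orthonormal_family f /\ forall v, v = \sum_p B v (f p) *: f p.
    by apply: (H (\dim {:V}) 0 (fun _ => 0)) => [[]//|]; rewrite subn0.
  elim: d => [|d IHd] k f fo le_d.
    exists k, f; split=> // v; apply/eqP/negPn/negP => /(orthonormal_extend fo)[g].
    by move/orthonormal_le_dim; rewrite ltnNge -subn_eq0 -leqn0 le_d.
  have [fc|] := boolP `[< forall v, v = \sum_p B v (f p) *: f p >].
    by exists k, f; split => // v; have /asboolP := fc; apply.
  move=> /asboolPn/existsNP[v /eqP/(orthonormal_extend fo)[g go]].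
  by apply: IHd go _; rewrite subnS -subn1 leq_subLR add1n.
suff <- : k = \dim {:V} by exists f.
apply/eqP; rewrite eqn_leq (orthonormal_le_dim fo) /=.
have : (fullv <= <<[tuple f p | p < k]>>)%VS.
  apply/subvP => v _; rewrite (fc v); apply: rpred_sum => p _.
  by apply/rpredZ/memv_span/mapP; exists p; rewrite ?mem_enum.
by move=> /dimvS le; apply: leq_trans le (leq_trans (dim_span _) _); rewrite size_tuple.
Qed.

Section OperatorMatrix.
Variables (k : nat) (f : 'I_k -> V).

(** Row p lists the coordinates of g (f p), so a composition becomes the product in reverse
    order. *)
Definition op_mx (g : V -> V) : 'M[R]_k := \matrix_(p, q) B (g (f p)) (f q).

Hypothesis fE : forall v, v = \sum_p B v (f p) *: f p.

Lemma op_mx_comp (g1 g2 : V -> V) : linear g1 ->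
  op_mx (g1 \o g2) = op_mx g2 *m op_mx g1.
Proof.
move=> g1lin; apply/matrixP => p q; rewrite !mxE /= [g2 (f p)]fE.
rewrite (lin_sum g1lin) dot_suml; apply: eq_bigr => r _.
by rewrite (linZ g1lin) dotZl !mxE.
Qed.

End OperatorMatrix.

End Theory.
End DotProducts.

Section InvariantDot.
Local Open Scope ring_scope.
Variables (R : realType) (V : vectType R).

Lemma is_dot_exists : exists B : V -> V -> R, is_dot B.
Proof.
pose x i u := coord (vbasis {:V}) i u.
exists (fun u v => \sum_i x i u * x i v); split.
- move=> w a u v; rewrite mulr_sumr -big_split; apply: eq_bigr => i _ /=.
  by rewrite /x linearP /=; ring.
- by move=> u v; apply: eq_bigr => i _; rewrite mulrC.
move=> u u0; rewrite lt_def sumr_ge0 ?andbT => [|i _]; last exact: sqr_ge0.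
apply: contra u0; rewrite psumr_eq0 => [/allP H|i _]; last exact: sqr_ge0.
rewrite (coord_vbasis (memvf u)); apply/eqP; apply: big1 => i _.
have := H i; rewrite mem_index_enum => /(_ isT)/=.
by rewrite -expr2 sqrf_eq0 => /eqP xi0; rewrite -/(x i u) xi0 scale0r.
Qed.

(* Averages a dot product successively over the groups {1, g j}. *)
Lemma invariant_dot_exists (J : eqType) (s : seq J) (g : J -> V -> V)
    (anti : rel J) :
    (forall j, linear (g j)) -> (forall j v, g j (g j v) = - v) ->
    (forall i j v, g i (g j v) = (-1) ^+ anti i j *: g j (g i v)) ->
  exists2 B : V -> V -> R,
    is_dot B & {in s, forall j u v, B (g j u) (g j v) = B u v}.
Proof.
move=> glin gsqr gcomm; elim: s => [|j s [B Bdot Binv]].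
  by have [B Bdot] := is_dot_exists; exists B.
exists (fun u v => B u v + B (g j u) (g j v)).
  split=> [w a u v|u v|u u0].
  - by rewrite glin !is_dot_linear //; ring.
  - by rewrite is_dotC // (is_dotC Bdot (g j u)).
  by apply: ltr_wpDr; [apply: dot_ge0|apply: is_dot_gt0].
move=> i; rewrite inE => /predU1P[->|si] u v.
  by rewrite !gsqr dotNl // dotNr // opprK addrC.
rewrite Binv // (gcomm j i u) (gcomm j i v) dotZl // dotZr // mulrA -expr2.
by rewrite sqrr_sign mul1r Binv.
Qed.

End InvariantDot.

(** * Representations of Lie type *)

Section LieTypeIntro.
Local Open Scope ring_scope.
Variables (R : realType) (h : lieAlg R) (V : vectType R) (rho : h -> V -> V).
Variables (Bh : h -> h -> R) (Bm : V -> V -> R) (r : V -> V -> h).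
Hypothesis rho_bil : bilinear_for *:%R *:%R rho.
Hypothesis rho_hom :
  forall x y v, rho (lbr x y) v = rho x (rho y v) - rho y (rho x v).
Hypotheses (Bh_dot : is_dot Bh) (Bm_dot : is_dot Bm).
Hypothesis Bh_inv : forall a b c, Bh (lbr a b) c + Bh b (lbr a c) = 0.
Hypothesis Bm_inv : forall a v w, Bm (rho a v) w + Bm v (rho a w) = 0.
Hypothesis rE : forall a v w, Bh a (r v w) = Bm (rho a v) w.
Hypothesis bianchi :
  forall u v w, rho (r u v) w + rho (r v w) u + rho (r w u) v = 0.

Let rho_linl v : linear (rho^~ v). Proof. exact: rho_bil.1. Qed.
Let rho_linr x : linear (rho x). Proof. exact: rho_bil.2. Qed.
Let lbr_linl y : linear (fun x : h => lbr x y).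
Proof. by have [[H _] _ _] := lbr_axiom h; apply: H. Qed.
Let lbr_linr x : linear (@lbr R h x).
Proof. by have [[_ H] _ _] := lbr_axiom h; apply: H. Qed.

Let r_inj x y : (forall a, Bh a x = Bh a y) -> x = y.
Proof.
by move=> xy; apply: (dot_inj Bh_dot) => a; rewrite !(is_dotC Bh_dot _ a).
Qed.

Let r_linl w : linear (r^~ w).
Proof.
move=> a u v; apply: r_inj => x; rewrite dotDr // dotZr // !rE.
by rewrite rho_linr is_dot_linear.
Qed.

Let r_linr u : linear (r u).
Proof.
by move=> a v w; apply: r_inj => x; rewrite dotDr // dotZr // !rE dotDr // dotZr.
Qed.

Let rC u v : r u v = - r v u.
Proof.
apply: r_inj => x; rewrite dotNr // !rE; apply/eqP.
by rewrite -addr_eq0 (is_dotC Bm_dot (rho x v)) Bm_inv.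
Qed.

Let r_equiv a u v : lbr a (r u v) = r (rho a u) v + r u (rho a v).
Proof.
apply: r_inj => c; rewrite dotDr // !rE.
have /eqP := Bh_inv a c (r u v); rewrite addrC addr_eq0 => /eqP->.
rewrite rE rho_hom dotDl // dotNl // opprD opprK addrC; congr (_ + _).
by apply/eqP; rewrite eq_sym -addr_eq0 addrC Bm_inv.
Qed.

(** The bracket on m is [r], with values in h. The Jacobi identity comes from [lbr_axiom] and
    [rho_hom], from the equivariance of [r] when two of the arguments are in m, and from [bianchi]
    when all three are. *)
Lemma of_lie_type_intro : of_lie_type rho.
Proof.
pose br (x y : h * V) : h * V :=
  (lbr x.1 y.1 + r x.2 y.2, rho x.1 y.2 - rho y.1 x.2).
have [_ alt jac] := lbr_axiom h.
exists (bundle_dot Bh_dot), (bundle_dot Bm_dot), br; split; split=> //.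
- split=> [|x|x y z].
  + split=> u a x y; apply: injective_projections => /=.
    * by rewrite lbr_linl r_linl scalerDr addrACA.
    * by rewrite rho_linl rho_linr scalerBr opprD addrACA.
    * by rewrite lbr_linr r_linr scalerDr addrACA.
    * by rewrite rho_linl rho_linr scalerBr opprD addrACA.
  + apply: injective_projections; rewrite /= ?alt ?subrr //.
    have /eqP := rC x.2 x.2; rewrite -addr_eq0 -mulr2n -scaler_nat scaler_eq0.
    by rewrite pnatr_eq0 add0r => /eqP.
  case: x y z => [a u] [b v] [c w]; apply: injective_projections => /=.
    rewrite !(linD (lbr_linr _)) !r_equiv !(linB (r_linr _)).
    rewrite (rC w (rho a v)) (rC u (rho b w)) (rC v (rho c u)).
    (* Pairing with an arbitrary x turns an identity of vectors into one of reals, within reach of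
       [lra]. *)
    apply: (dot_inj Bh_dot) => x; have := congr1 (Bh^~ x) (jac a b c).
    by rewrite !(dotDl Bh_dot, dotNl Bh_dot, dot0l Bh_dot); lra.
  rewrite !(linB (rho_linr _)) !(linD (rho_linl _)) !rho_hom.
  apply: (dot_inj Bm_dot) => x; have := congr1 (Bm^~ x) (bianchi u v w).
  by rewrite !(dotDl Bm_dot, dotNl Bm_dot, dot0l Bm_dot); lra.
- by move=> a b; rewrite /br /= (lin0 (r_linr _)) !(lin0 (rho_linr _)) subrr addr0.
- move=> a v; rewrite /br /= (lin0 (r_linl _)) (lin0 (lbr_linr _)).
  by rewrite (lin0 (rho_linl _)) subr0 addr0.
- move=> a v; rewrite /br /= (lin0 (r_linr _)) (lin0 (lbr_linl _)).
  by rewrite (lin0 (rho_linl _)) sub0r addr0.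
by move=> a v w; rewrite /br /= !bundle_dotE (lin0 (lbr_linl _)) add0r rE.
Qed.

End LieTypeIntro.

(** * Weights on a basis of complex structures that commute or anticommute *)

Section CliffordBasis.
Local Open Scope ring_scope.
Variables (R : realType) (h : lieAlg R) (V : vectType R) (rho : h -> V -> V).
Variables (I : finType) (X : I -> h) (anti : rel I).

(** The family (a_i) in abstract form, [anti i j] meaning chi_ij = -1. The separation axiom makes
    distinct members orthogonal for the trace, hence the family linearly independent. *)
Record clifford_basis : Prop := CliffordBasis {
  cb_bilinear : bilinear_for *:%R *:%R rho;
  cb_hom : forall x y v, rho (lbr x y) v = rho x (rho y v) - rho y (rho x v);
  cb_span : forall x, exists t : I -> R, x = \sum_i t i *: X i;
  cb_sqr : forall i v, rho (X i) (rho (X i) v) = - v;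
  cb_comm : forall i j v, rho (X i) (rho (X j) v) =
              (-1) ^+ anti i j *: rho (X j) (rho (X i) v);
  cb_sym : symmetric anti;
  cb_sep : forall i j, i != j -> exists l, anti l i (+) anti l j;
  cb_dim : (0 < \dim {:V})%N }.

Hypothesis cb : clifford_basis.

Let N : nat := \dim {:V}.
Let rho_linl v : linear (rho^~ v). Proof. exact: (cb_bilinear cb).1. Qed.
Let rho_linr x : linear (rho x). Proof. exact: (cb_bilinear cb).2. Qed.
Let lbr_linl y : linear (fun x : h => lbr x y).
Proof. by have [[H _] _ _] := lbr_axiom h; apply: H. Qed.
Let lbr_linr x : linear (@lbr R h x).
Proof. by have [[_ H] _ _] := lbr_axiom h; apply: H. Qed.
Let lbrC (x y : h) : lbr x y = - lbr y x.
Proof.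
have [_ alt _] := lbr_axiom h; apply/eqP; rewrite -addr_eq0; apply/eqP.
have := alt (x + y); rewrite (linD (lbr_linl _)) !(linD (lbr_linr _)) !alt.
by rewrite add0r addr0.
Qed.

Section Matrices.
Variables (B : V -> V -> R) (f : 'I_N -> V).
Hypothesis Bdot : is_dot B.
Hypothesis Binv : forall x u v, B (rho x u) v + B u (rho x v) = 0.
Hypothesis f_on : orthonormal_family B f.
Hypothesis fE : forall v, v = \sum_p B v (f p) *: f p.

Definition rho_mx (x : h) : 'M[R]_N := op_mx B f (rho x).

Lemma rho_mx_comp x y p q :
  B (rho x (rho y (f p))) (f q) = (rho_mx y *m rho_mx x) p q.
Proof. by rewrite -(op_mx_comp Bdot fE) // mxE. Qed.

Lemma rho_mx_sqr i : rho_mx (X i) *m rho_mx (X i) = - 1%:M.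
Proof.
apply/matrixP => p q; rewrite -rho_mx_comp (cb_sqr cb) dotNl // f_on.
by rewrite !mxE.
Qed.

Lemma rho_mx_comm i j : rho_mx (X i) *m rho_mx (X j) =
  (-1) ^+ anti i j *: (rho_mx (X j) *m rho_mx (X i)).
Proof.
apply/matrixP => p q; rewrite -rho_mx_comp (cb_comm cb) (cb_sym cb) dotZl //.
by rewrite mxE -rho_mx_comp.
Qed.

Lemma rho_mx_skew x p q : rho_mx x q p = - rho_mx x p q.
Proof.
by rewrite !mxE; apply/eqP; rewrite -addr_eq0 (is_dotC Bdot (rho x (f p))) Binv.
Qed.

Lemma basis_ind (P : V -> Prop) : (forall p, P (f p)) ->
  (forall a u v, P u -> P v -> P (a *: u + v)) -> forall v, P v.
Proof.
move=> Pf PD v.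
have P0 (p : 'I_N) : P 0 by rewrite -(addNr (f p)) -scaleN1r; apply: PD.
have N_gt0 : (0 < N)%N := cb_dim cb.
rewrite [v]fE; elim/big_ind: _ => [|x y Px Py|p _].
- exact: (P0 (Ordinal N_gt0)).
- by rewrite -[x]scale1r; apply: PD.
by rewrite -[_ *: _]addr0; apply/PD/P0.
Qed.

Lemma rho_mx_linear : linear rho_mx.
Proof.
by move=> a x y; apply/matrixP => p q; rewrite !mxE rho_linl is_dot_linear.
Qed.

Lemma rho_mx_lbr x y :
  rho_mx (lbr x y) = rho_mx y *m rho_mx x - rho_mx x *m rho_mx y.
Proof.
apply/matrixP => p q; rewrite mxE (cb_hom cb) dotDl // dotNl //.
by rewrite !rho_mx_comp !mxE.
Qed.

(** The trace form is - N times the identity on the basis, so this is the coordinate of x along X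
    j. *)
Definition rho_coord j x := - (\tr (rho_mx x *m rho_mx (X j)) / N%:R).

Lemma rho_coord_linear j : linear (rho_coord j : h -> R^o).
Proof.
move=> a x y; rewrite /rho_coord rho_mx_linear mulmxDl -scalemxAl raddfD /=.
by rewrite mxtraceZ /GRing.scale /=; ring.
Qed.

Lemma rho_coordX i j : rho_coord j (X i) = (i == j)%:R.
Proof.
rewrite /rho_coord (mxtrace_clifford2 rho_mx_sqr rho_mx_comm (cb_sep cb)).
by rewrite mulNr opprK mulrAC mulfV ?mul1r // pnatr_eq0 -lt0n (cb_dim cb).
Qed.

Lemma rho_coordE x : x = \sum_i rho_coord i x *: X i.
Proof.
have [t xt] := cb_span cb x; rewrite {1}xt; apply: eq_bigr => i _.
congr (_ *: _); rewrite xt (lin_sum (rho_coord_linear i)) (bigD1 i) //=.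
rewrite (linZ (rho_coord_linear i)) rho_coordX eqxx big1 ?addr0 => [|j neji].
  by rewrite /GRing.scale /= mulr1.
by rewrite (linZ (rho_coord_linear i)) rho_coordX (negbTE neji) scaler0.
Qed.

Lemma rho_faithful x y : (forall v, rho x v = rho y v) -> x = y.
Proof.
move=> xy; rewrite (rho_coordE x) (rho_coordE y); apply: eq_bigr => i _.
rewrite /rho_coord; congr (- (\tr (_ *m _) / _) *: _).
by apply/matrixP => p q; rewrite !mxE xy.
Qed.

Section Weights.
Variable w : I -> R.

(** The first argument of B on the right is the Jacobi sum of three vectors of m for the bracket
    [u, v] = \sum_i w_i B(X_i u, v) X_i, which condition (3) dictates if the X_i are orthogonal of
    squared norms 1 / w_i. *)
Lemma four_formE p q r s :
  four_form (rho_mx \o X) w p q r s =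
  B (\sum_i (w i * B (rho (X i) (f p)) (f q)) *: rho (X i) (f r)
     + \sum_i (w i * B (rho (X i) (f q)) (f r)) *: rho (X i) (f p)
     + \sum_i (w i * B (rho (X i) (f r)) (f p)) *: rho (X i) (f q)) (f s).
Proof.
rewrite !dotDl // !dot_suml // -!big_split /four_form; apply: eq_bigr => i _ /=.
by rewrite !dotZl // !mxE; ring.
Qed.

Lemma four_form_cb_eq0 :
  (forall j, 0 < w j) ->
  (forall j, N%:R * w j <= (\sum_i w i * (-1) ^+ anti i j) *+ 2) ->
  forall p q r s, four_form (rho_mx \o X) w p q r s = 0.
Proof.
move=> w_gt0 w_le; apply: four_form_eq0 => [i p q|]; first exact: rho_mx_skew.
apply: sumr_le0 => j _; rewrite /= (four_form_contract_clifford (anti := anti)).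
- by rewrite pmulr_rle0 // pmulr_rle0 ?ltr0n ?(cb_dim cb) // subr_le0 mulrC.
- exact: rho_mx_sqr.
- exact: rho_mx_comm.
- exact: (cb_sep cb).
Qed.

Lemma four_form_cb_weights :
  (forall p q r s, four_form (rho_mx \o X) w p q r s = 0) ->
  forall j, N%:R * w j = (\sum_i w i * (-1) ^+ anti i j) *+ 2.
Proof.
move=> om0 j.
have /eqP := four_form_contract_clifford w rho_mx_sqr rho_mx_comm (cb_sep cb) j.
rewrite -four_form_contract; last by move=> *; apply: rho_mx_skew.
rewrite big1 => [|p _]; last by do 3![apply: big1 => ? _]; rewrite om0 mulr0.
rewrite eq_sym mulf_eq0 pnatr_eq0 -leqn0 leqNgt (cb_dim cb) /= subr_eq0.
by rewrite mulrC => /eqP.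
Qed.

(** The product on h for which the X i are orthogonal of squared norms 1 / w i is ad-invariant
    because the weights agree on anticommuting pairs; the inequalities make the four-form vanish,
    which is the Jacobi identity on m. *)
Lemma lie_type_of_weights_basis :
  (forall j, 0 < w j) -> (forall i j, anti i j -> w i = w j) ->
  (forall j, N%:R * w j <= (\sum_i w i * (-1) ^+ anti i j) *+ 2) ->
  of_lie_type rho.
Proof.
move=> w_gt0 w_anti w_le.
pose Bh x y := \sum_i (w i)^-1 * (rho_coord i x * rho_coord i y).
have Bh_dot : is_dot Bh.
  split=> [z a x y|x y|x x0].
  - rewrite /Bh mulr_sumr -big_split; apply: eq_bigr => i _ /=.
    rewrite (linD (rho_coord_linear _)) (linZ (rho_coord_linear _)).
    by rewrite /GRing.scale /=; ring.
  - by apply: eq_bigr => i _; rewrite [in RHS]mulrC; ring.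
  have ge0 i : 0 <= (w i)^-1 * (rho_coord i x * rho_coord i x).
    by rewrite mulr_ge0 ?invr_ge0 ?(ltW (w_gt0 _)) // -expr2 sqr_ge0.
  rewrite lt_def sumr_ge0 // andbT; apply: contra x0.
  rewrite psumr_eq0 // => /allP H; apply/eqP; rewrite (rho_coordE x).
  apply: big1 => i _; have := H i; rewrite mem_index_enum => /(_ isT)/=.
  rewrite mulf_eq0 invr_eq0 gt_eqF //= mulf_eq0 orbb => /eqP->.
  by rewrite scale0r.
have BhX i x : Bh (X i) x = (w i)^-1 * rho_coord i x.
  rewrite /Bh (bigD1 i) //= rho_coordX eqxx mul1r big1 ?addr0 // => j neji.
  by rewrite rho_coordX eq_sym (negbTE neji) mul0r mulr0.
pose r u v := \sum_i (w i * B (rho (X i) u) v) *: X i.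
have rE a u v : Bh a (r u v) = B (rho a u) v.
  rewrite (rho_coordE a) dot_suml // (lin_sum (rho_linl _)) dot_suml //.
  apply: eq_bigr => i _; rewrite (linZ (rho_linl _)) !dotZl //; congr (_ * _).
  rewrite BhX (lin_sum (rho_coord_linear _)) (bigD1 i) //= big1 => [|j neji].
    rewrite (linZ (rho_coord_linear _)) rho_coordX eqxx addr0 /GRing.scale /= mulr1.
    by rewrite mulKf // gt_eqF.
  by rewrite (linZ (rho_coord_linear _)) rho_coordX (negbTE neji) scaler0.
have r_linl v : linear (r^~ v).
  move=> a u u'; rewrite /r scaler_sumr -big_split; apply: eq_bigr => i _ /=.
  by rewrite rho_linr is_dot_linear // scalerA -scalerDl; congr (_ *: _); ring.
have r_linr u : linear (r u).
  move=> a v v'; rewrite /r scaler_sumr -big_split; apply: eq_bigr => i _ /=.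
  by rewrite dotDr // dotZr // scalerA -scalerDl; congr (_ *: _); ring.
apply: (of_lie_type_intro (cb_bilinear cb) (cb_hom cb) Bh_dot Bdot _ Binv rE); last first.
  (* S is cyclic and linear in its last argument, so the arguments are rotated into the last place
     and replaced in turn by basis vectors. *)
  pose S u v z := rho (r u v) z + rho (r v z) u + rho (r z u) v.
  have Sl u v a z z' : S u v (a *: z + z') = a *: S u v z + S u v z'.
    apply: (dot_inj Bdot) => x.
    rewrite /S rho_linr r_linr r_linl !rho_linl.
    by rewrite !(dotDl Bdot, dotZl Bdot); ring.
  have Scyc u v z : S u v z = S v z u by rewrite /S -addrA [LHS]addrC.
  have Sind (P : V -> V -> Prop) : (forall u v p, P u v -> S u v (f p) = 0) ->
      forall u v z, P u v -> S u v z = 0.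
    move=> Pf u v z Puv; elim/basis_ind: z => [p|a z z' IHz IHz']; first exact: Pf.
    by rewrite Sl IHz IHz' scaler0 addr0.
  move=> u v z; apply: (Sind (fun _ _ => True)) => // {}u {}v p _.
  rewrite -Scyc; apply: (Sind (fun u v => u = f p)) => // {}u {}v q ->.
  rewrite -Scyc; apply: (Sind (fun u v => u = f q /\ v = f p)) => // {}u {}v t [-> ->].
  rewrite [LHS]fE; apply: big1 => s _.
  have := four_form_cb_eq0 w_gt0 w_le q p t s; rewrite four_formE.
  have rS u' v' z' : rho (r u' v') z' =
      \sum_i (w i * B (rho (X i) u') v') *: rho (X i) z'.
    rewrite /r (lin_sum (rho_linl _)); apply: eq_bigr => i _.
    by rewrite (linZ (rho_linl _)).
  by rewrite /S !rS => ->; rewrite scale0r.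
move=> a b c; rewrite (rho_coordE a) (lin_sum (lbr_linl _)).
  rewrite (lin_sum (lbr_linl _)) dot_suml // dot_sumr // -big_split big1 // => l _ /=.
  rewrite !(linZ (lbr_linl _)) dotZl // dotZr // -mulrDr.
  rewrite [X in _ * X](_ : _ = 0) ?mulr0 //.
  rewrite (rho_coordE b) (lin_sum (lbr_linr _)) !dot_suml // -big_split big1 // => i _ /=.
  rewrite (linZ (lbr_linr _)) !dotZl // -mulrDr.
  rewrite [X in _ * X](_ : _ = 0) ?mulr0 //.
  rewrite (rho_coordE c) (lin_sum (lbr_linr _)) !dot_sumr // -big_split big1 // => j _ /=.
  rewrite (linZ (lbr_linr _)) !dotZr // -mulrDr.
  rewrite [X in _ * X](_ : _ = 0) ?mulr0 //.
  rewrite is_dotC // !BhX.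
  pose M i := rho_mx (X i).
  have e1 : \tr (M j *m M l *m M i) = \tr (M l *m M i *m M j).
    by rewrite -mulmxA mxtrace_mulC.
  (* The structure constants are skew in i and j, by cyclicity of the trace. *)
  have e : rho_coord j (lbr (X l) (X i)) = - rho_coord i (lbr (X l) (X j)).
    rewrite /rho_coord !rho_mx_lbr !mulmxBl !raddfB /= e1.
    by rewrite -(mulmxA (M i)) [\tr (M i *m _)]mxtrace_mulC; ring.
  have [/w_anti->|nanti] := boolP (anti i j); first by rewrite e; ring.
  (* If X i and X j commute, the constant vanishes, so w i and w j may differ. *)
  have c0 : rho_coord i (lbr (X l) (X j)) = 0 :> R.
    rewrite /rho_coord !rho_mx_lbr !mulmxBl !raddfB /= e1 -mulmxA.
    by rewrite /M rho_mx_comm (negbTE nanti) scale1r mulmxA subrr mul0r oppr0.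
  by rewrite e c0 oppr0 !mulr0 addr0.
Qed.

End Weights.

End Matrices.

Theorem lie_type_of_weights (w : I -> R) :
  (forall j, 0 < w j) -> (forall i j, anti i j -> w i = w j) ->
  (forall j, N%:R * w j <= (\sum_i w i * (-1) ^+ anti i j) *+ 2) ->
  of_lie_type rho.
Proof.
have [B Bdot BX] := invariant_dot_exists (index_enum I)
  (fun i => rho_linr (X i)) (cb_sqr cb) (cb_comm cb).
have [f [fon fE]] := orthonormal_basis Bdot.
have Binv x u v : B (rho x u) v + B u (rho x v) = 0.
  have [t ->] := cb_span cb x.
  rewrite !(lin_sum (rho_linl _)) dot_suml // dot_sumr // -big_split big1 // => i _ /=.
  rewrite !(linZ (rho_linl _)) dotZl // dotZr // -mulrDr.
  (* An isometry of square -1 is skew. *)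
  by rewrite -(BX i (mem_index_enum _)) (cb_sqr cb) dotNl // addNr mulr0.
exact: lie_type_of_weights_basis Bdot Binv fon fE w.
Qed.

(** The weights are the inverse squared norms of the X i. Ad-invariance of [Bh] makes the X i
    orthogonal, with equal norms on anticommuting pairs; the Jacobi identity on m then kills the
    four-form, and its contractions are the equations. *)
Theorem weights_of_lie_type : of_lie_type rho ->
  exists w : I -> R,
  [/\ forall j, 0 < w j, forall i j, anti i j -> w i = w j &
   forall j, N%:R * w j = (\sum_i w i * (-1) ^+ anti i j) *+ 2].
Proof.
case=> Bh [Bm [br [[Bh_inv Bm_inv [[br_linl br_linr] br_alt br_jac]]]]].
case=> br_hh br_hm br_mh br_mm.
have Bhd := dot_is_dot Bh; have Bmd := dot_is_dot Bm.
have [f [fon fE]] := orthonormal_basis Bmd.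
have faithful := rho_faithful Bmd fon fE.
have X0 i : X i != 0.
  apply/eqP => Xi0.
  have [v v0] : exists v : V, v != 0.
    exists (f (Ordinal (cb_dim cb))); apply/eqP => /(congr1 (fun u => Bm u u)).
    by rewrite fon eqxx (dot0l Bmd) => /eqP; rewrite oner_eq0.
  have := cb_sqr cb i v; rewrite Xi0 (lin0 (rho_linl _)) => /eqP.
  by rewrite eq_sym oppr_eq0 (negbTE v0).
have rhoZ a x v : rho (a *: x) v = a *: rho x v := linZ (rho_linl v) a x.
have lbr_comm i j : ~~ anti i j -> lbr (X i) (X j) = 0.
  move=> nij; apply: faithful => v.
  by rewrite (cb_hom cb) (cb_comm cb) (negbTE nij) scale1r subrr (lin0 (rho_linl _)).
(* Half the bracket of an anticommuting pair acts as the product of the two operators. *)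
have lbr_anti i j v : anti i j ->
    rho (2^-1 *: lbr (X i) (X j)) v = rho (X i) (rho (X j) v).
  move=> aij; rewrite rhoZ (cb_hom cb) (cb_comm cb j i) (cb_sym cb) aij.
  rewrite scaleN1r opprK -mulr2n -scaler_nat scalerA mulVf ?scale1r //.
  by rewrite pnatr_eq0.
have lbr_anti2 i j : anti i j ->
    lbr (X i) (2^-1 *: lbr (X i) (X j)) = - 2 *: X j.
  move=> aij; apply: faithful => v; rewrite (cb_hom cb) !lbr_anti // (cb_sqr cb).
  rewrite rhoZ (cb_comm cb j i) (cb_sym cb) aij scaleN1r (linN (rho_linr _)).
  by rewrite (cb_sqr cb) opprK -opprD scaleNr scaler_nat mulr2n.
have Bh_orth i j : i != j -> Bh (X i) (X j) = 0.
  (* X a lies in the image of ad (X l), X b in its kernel, and ad (X l) is skew. *)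
  have half l a b : anti l a -> ~~ anti l b -> Bh (X a) (X b) = 0.
    move=> la lb; have := Bh_inv (X l) (2^-1 *: lbr (X l) (X a)) (X b).
    rewrite (lbr_anti2 l a la) (lbr_comm l b lb) (dotZl Bhd) (is_dotC Bhd _ 0).
    rewrite (dot0l Bhd).
    by rewrite addr0 => /eqP; rewrite mulf_eq0 oppr_eq0 pnatr_eq0 => /eqP.
  move=> /(cb_sep cb)[l]; case la: (anti l i); case lb: (anti l j) => // _.
    by apply: (half l); rewrite ?lb.
  by rewrite (is_dotC Bhd); apply: (half l); rewrite ?la.
(* The half bracket generates rotations of the plane of X i and X j, so the two norms agree. *)
have Bh_anti i j : anti i j -> Bh (X i) (X i) = Bh (X j) (X j).
  move=> aij; have aji : anti j i by rewrite (cb_sym cb).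
  have e : 2^-1 *: lbr (X i) (X j) = - (2^-1 *: lbr (X j) (X i)) by rewrite lbrC scalerN.
  have := Bh_inv (2^-1 *: lbr (X i) (X j)) (X i) (X j).
  rewrite {2}e lbrC lbr_anti2 // (lbrC (- _)) (linN (lbr_linr _)) opprK lbr_anti2 //.
  by rewrite -scaleNr opprK (dotZl Bhd) (dotZr Bhd); lra.
pose w i := (Bh (X i) (X i))^-1.
exists w; split=> [j|i j /Bh_anti|j].
- by rewrite invr_gt0 (is_dot_gt0 Bhd).
- by rewrite /w => ->.
apply: (four_form_cb_weights Bmd Bm_inv fon fE) => p q r s.
rewrite four_formE //.
pose T u v := (br (0, u) (0, v)).2; pose rr u v := (br (0, u) (0, v)).1.
have br_skew x y : br x y = - br y x.
  apply/eqP; rewrite -addr_eq0; apply/eqP; have := br_alt (x + y).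
  by rewrite (linD (br_linl _)) !(linD (br_linr _)) !br_alt add0r addr0.
have brE u v : br (0, u) (0, v) = (rr u v, 0) + (0, T u v).
  by apply: injective_projections; rewrite /= ?addr0 ?add0r.
have T_linr u : linear (T u).
  move=> a v v'; rewrite /T.
  have -> : (0, a *: v + v') = a *: (0, v) + (0, v') :> h * V.
    by apply: injective_projections; rewrite /= ?scaler0 ?addr0.
  by rewrite br_linr.
have T_skew u v : T u v = - T v u by rewrite /T br_skew.
have T_equiv x u v : rho x (T u v) = T (rho x u) v + T u (rho x v).
  have := congr1 snd (br_jac (x, 0) (0, u) (0, v)).
  rewrite br_mh br_hm brE (linD (br_linr _)) br_hh br_hm /= add0r.
  rewrite -!/(T _ _) (linN (T_linr _)) (T_skew v) => /eqP.
  by rewrite -addrA -opprD subr_eq0 addrC => /eqP.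
have TNl u v : T (- u) v = - T u v.
  by rewrite T_skew (linN (T_linr _)) (T_skew u).
(* Any X j will do: acting with it twice on T(a, b) gives T(a, b) = 2 T(X_j a, X_j b), and iterating
   this gives T = 4 T. *)
have T0 u v : T u v = 0.
  have Tdouble a b : T a b = 2 *: T (rho (X j) a) (rho (X j) b).
    have := cb_sqr cb j (T a b); rewrite T_equiv (linD (rho_linr _)) !T_equiv.
    rewrite !(cb_sqr cb) TNl (linN (T_linr _)) => e.
    apply: (dot_inj Bmd) => x; have := congr1 (Bm^~ x) e.
    by rewrite !(dotDl Bmd, dotNl Bmd, dotZl Bmd); lra.
  apply: (dot_inj Bmd) => x; have := congr1 (Bm^~ x) (Tdouble u v).
  rewrite (Tdouble (rho (X j) u)) !(cb_sqr cb) TNl (linN (T_linr _)) opprK.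
  by rewrite !(dotZl Bmd) (dot0l Bmd); lra.
have bianchi u v z : rho (rr u v) z + rho (rr v z) u + rho (rr z u) v = 0.
  have := congr1 snd (br_jac (0, z) (0, u) (0, v)).
  rewrite !brE !T0 !addr0 !br_mh /= => /eqP.
  by rewrite -!opprD oppr_eq0 => /eqP.
have rrE u v z :
    rho (rr u v) z = \sum_i (w i * Bm (rho (X i) u) v) *: rho (X i) z.
  have [t rt] := cb_span cb (rr u v).
  rewrite rt (lin_sum (rho_linl _)); apply: eq_bigr => i _.
  rewrite rhoZ -br_mm -/(rr u v) rt (dot_sumr Bhd) (bigD1 i) //= big1 => [|k neki].
    rewrite (dotZr Bhd) addr0 mulrCA mulVf ?mulr1 //.
    by rewrite gt_eqF // (is_dot_gt0 Bhd).
  by rewrite (dotZr Bhd) Bh_orth ?mulr0 // eq_sym.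
by rewrite -!rrE bianchi (dot0l Bmd).
Qed.
End CliffordBasis.

(** * Clifford modules and their dimension *)

Section CliffordBasisElements.
Local Open Scope ring_scope.
Variables (R : realType) (m : nat).
Implicit Types (A B : {set 'I_m}) (x y : Cl R m).

Lemma clbase_gen A i : i \in A -> exists s : bool,
  clbase A = (-1) ^+ s *: (clgen i * clbase (A :\ i)) :> Cl R m.
Proof.
move=> iA; exists (odd (clsign [set i] (A :\ i))).
rewrite clbaseM scalerA signr_odd -expr2 sqrr_sign scale1r; congr clbase.
by apply/setP => j; rewrite !inE; case: eqP => [->|].
Qed.

Lemma cl_gen_ind (P : Cl R m -> Prop) : P 1 ->
  (forall i x, P x -> P (clgen i * x)) ->
  (forall a x y, P x -> P y -> P (a *: x + y)) -> forall x, P x.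
Proof.
move=> P1 PM PD x; elim/(@clbase_ind R m): x => [A|a x y]; last exact: PD.
have P0 : P 0 by rewrite -(addNr 1) -scaleN1r; apply: PD.
elim: {A}#|A| {-2}A (leqnn #|A|) => [|k IHk] A.
  by rewrite leqn0 cards_eq0 => /eqP->.
have [->|[i iA]] := set_0Vmem A; first by [].
have [s ->] := clbase_gen iA; rewrite (cardsD1 i) iA => le_k.
by rewrite -[_ *: _]addr0; apply: PD => //; apply/PM/IHk.
Qed.

Lemma signr_swap A B : (-1) ^+ clsign A B =
  (-1) ^+ odd (#|A| * #|B| + #|A :&: B|) * (-1) ^+ clsign B A :> R.
Proof.
by rewrite -clsign_swap signr_odd exprD -mulrA -expr2 sqrr_sign mulr1.
Qed.

Lemma clbase_comm A B : clbase A * clbase B =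
  (-1) ^+ odd (#|A| * #|B| + #|A :&: B|) *: (clbase B * clbase A) :> Cl R m.
Proof. by rewrite !clbaseM scalerA signr_swap (symdiffC B). Qed.

Lemma symdiffvv A : symdiff A A = set0.
Proof. by apply/setP => i; rewrite !inE addbb. Qed.

Lemma clbase_sqr A :
  clbase A * clbase A = (-1) ^+ odd 'C(#|A|.+1, 2) *: 1 :> Cl R m.
Proof.
rewrite clbaseM symdiffvv signr_odd; congr (_ ^+ _ *: _).
have := clsign_swap A A; rewrite setIid addnn -mulnSr bin2 mulnC => <-.
by rewrite doubleK.
Qed.

Lemma card_even_set A : #|even_set A| = (#|A| + odd #|A|)%N.
Proof. by rewrite card_lift even_setK even_set_max. Qed.

(** In the even part of Cl_(m+1) all basis sets have even size, so the parity of the intersection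
    alone decides the commutation sign. *)
Lemma odd_even_setI A B :
  odd (#|A| * #|B| + #|A :&: B|) = odd #|even_set A :&: even_set B|.
Proof.
rewrite [in RHS]card_lift !oddD oddM inE !even_set_max oddb addbC.
congr (odd #|pred_of_set _| (+) _).
by apply/setP => i; rewrite in_setI [RHS]inE in_setI !even_set_lift.
Qed.

(** These A index the e_A of Cl_m that correspond to the e_i e_j of Cl_(m+1); A is a singleton when
    j is the last index. *)
Definition is_bivector A := #|even_set A| == 2.

Lemma bivector_card A : is_bivector A = (#|A| == 1%N) || (#|A| == 2).
Proof. by rewrite /is_bivector card_even_set; case: #|A| => [|[|[|k]]]. Qed.

Lemma clbase_bivector_sqr A :
  is_bivector A -> clbase A * clbase A = -1 :> Cl R m.
Proof.
by rewrite bivector_card clbase_sqr => /orP[] /eqP->; rewrite scaleN1r.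
Qed.

Lemma bivector_gen (i : 'I_m) : is_bivector [set i].
Proof. by rewrite bivector_card cards1. Qed.

Lemma spin_space_base A : is_bivector A -> clbase A \in spin_space R m.+1.
Proof.
by move=> /eqP A2; rewrite -memv_preim lfunE /= even_map_base bivectors_base.
Qed.

Lemma spin_spaceE x : x \in spin_space R m.+1 ->
  x = \sum_(A : {set 'I_m} | is_bivector A) x A *: clbase A.
Proof.
rewrite -memv_preim lfunE /= => xb; rewrite [LHS]clbaseE.
rewrite (bigID is_bivector) /= [X in _ + X]big1 ?addr0 // => A nA.
have := bivectors_supp xb nA; rewrite ffunE odd_even_set even_setK => ->.
by rewrite scale0r.
Qed.

End CliffordBasisElements.

Section SpinorClifford.
Local Open Scope ring_scope.
Variables (R : realType) (m : nat).

(** The generators of Cl_m lie in spin(m + 1), so a summand stable under the Lie algebra is stable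
    under Cl_m; d is the Clifford action on that summand, carried through f. *)
Lemma subrep_clifford (V V' W : vectType R)
    (sigma : lie_spin R m.+1 -> V -> V) (sigma' : lie_spin R m.+1 -> V' -> V')
    (tau : lie_spin R m.+1 -> W -> W) (c : Cl R m -> W -> W) :
  algebra_rep c -> (forall a v, tau a v = c (vsval a) v) ->
  equivalent_rep tau (rep_dsum sigma sigma') ->
  exists2 d : Cl R m -> V -> V,
    algebra_rep d & forall a v, sigma a v = d (vsval a) v.
Proof.
move=> [[c_linl c_linr] c1 cM] tauE [f [[g fK gK] ftau]].
have g_lin : linear g.
  by move=> a u v; apply: (can_inj fK); rewrite gK linearP /= !gK.
pose d x v := (f (c x (g (v, 0)))).1.
have f0 x v : (f (c x (g (v, 0)))).2 = 0.
  elim/cl_gen_ind: x => [|i x IHx|a x y IHx IHy].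
  - by rewrite c1 gK.
  - rewrite cM; set u := c x _.
    pose b : lie_spin R m.+1 := vsproj _ (clgen i).
    have bE : vsval b = clgen i.
      by rewrite vsprojK // spin_space_base ?bivector_gen.
    rewrite -bE -tauE ftau /rep_dsum /= IHx.
    (* As [sigma'] is a bare function, its value 0 at 0 is read off from [tau]. *)
    have := ftau b 0; rewrite tauE (lin0 (c_linr _)) linear0.
    by move/(congr1 snd).
  by rewrite c_linl linearP /= IHx IHy scaler0 addr0.
have dE x v : c x (g (v, 0)) = g (d x v, 0).
  by apply: (can_inj fK); rewrite gK [LHS]surjective_pairing f0.
have pairP a (u v : V) : (a *: u + v, 0) = a *: (u, 0) + (v, 0) :> V * V'.
  by apply: injective_projections; rewrite /= ?scaler0 ?addr0.
exists d; last first.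
  by move=> a v; rewrite /d -tauE ftau gK.
split=> [|v|x y v].
- split=> u a x y; first by rewrite /d c_linl linearP.
  by rewrite /d pairP g_lin c_linr linearP.
- by rewrite /d c1 gK.
by rewrite {1}/d cM dE.
Qed.

(** If 4 does not divide m + 1, the Clifford representation is itself irreducible. Otherwise the
    half-spin summand inherits a Clifford action, irreducible because its restriction to spin is. *)
Lemma spinor_clifford (V : vectType R) (sigma : lie_spin R m.+1 -> V -> V) :
  plus_spinor_rep sigma ->
  exists2 c : Cl R m -> V -> V,
    irreducible_algebra_rep c & forall a v, sigma a v = c (vsval a) v.
Proof.
rewrite /plus_spinor_rep; case: ifPn => [_|n4]; last first.
  case=> c; rewrite /clifford_rep; case: ifPn => [m3|_ irr sE]; last by exists c.
  have m3' : (m %% 4 = 3)%N by apply/eqP.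
  by case/negP: n4; rewrite -addn1 -modnDml m3'.
case=> [[V0 sirr]] [V' [W [sigma' [tau [_ [c cP tauE] eqv]]]]].
have c_alg : algebra_rep c.
  by move: cP; rewrite /clifford_rep; case: ifP => _ [].
have [d d_alg dE] := subrep_clifford c_alg tauE eqv.
exists d => //; split=> //; split=> // U Uinv.
by apply: sirr => a v vU; rewrite dE; apply: Uinv.
Qed.

End SpinorClifford.

(** * Upper and lower bounds for the dimension of a Clifford module *)

Section CliffordDimension.
Local Open Scope ring_scope.
Variables (R : realType) (m : nat) (V : vectType R) (c : Cl R m -> V -> V).
Hypothesis c_alg : algebra_rep c.

Let c_linl v : linear (c^~ v). Proof. by have [[H _] _ _] := c_alg; apply: H. Qed.
Let c_linr x : linear (c x). Proof. by have [[_ H] _ _] := c_alg; apply: H. Qed.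
Let c1 v : c 1 v = v. Proof. by have [_ H _] := c_alg; apply: H. Qed.
Let cM x y v : c (x * y) v = c x (c y v).
Proof. by have [_ _ H] := c_alg; apply: H. Qed.

(** For an involution, either u has eigenvalue -1 or u plus its image is a nonzero fixed vector;
    commutation keeps the eigenvalues found before. *)
Lemma common_eigenvector (s : seq {set 'I_m}) (v : V) : v != 0 ->
  {in s, forall A, clbase A * clbase A = 1 :> Cl R m} ->
  {in s &, forall A B, clbase A * clbase B = clbase B * clbase A :> Cl R m} ->
  exists2 u, u != 0 &
    {in s, forall A, exists e : bool, c (clbase A) u = (-1) ^+ e *: u}.
Proof.
move=> v0; elim: s => [|A s IHs] sqr comm; first by exists v.
have [B sB|B C sB sC|u u0 us] := IHs.
- by apply: sqr; rewrite inE sB orbT.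
- by apply: comm; rewrite inE ?sB ?sC orbT.
have sqrA : c (clbase A) (c (clbase A) u) = u by rewrite -cM sqr ?mem_head.
have [uA|uA] := eqVneq (c (clbase A) u) (- u).
  exists u => // B; rewrite inE => /predU1P[->|/us//].
  by exists true; rewrite scaleN1r.
exists (u + c (clbase A) u); first by rewrite addrC addr_eq0.
move=> B; rewrite inE => /predU1P[->|sB].
  by exists false; rewrite scale1r (linD (c_linr _)) sqrA addrC.
have [e ue] := us B sB; exists e; rewrite (linD (c_linr _)) ue -cM.
by rewrite comm ?mem_head ?inE ?sB ?orbT // cM ue (linZ (c_linr _)) scalerDr.
Qed.

(* The orbit of a common eigenvector of the [clbase (g k)] is spanned, up to
   sign, by its images under the [clbase A] with A avoiding the pivots. *)
Lemma irreducible_clifford_le_dim (s : nat) (g : 'I_s -> {set 'I_m})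
    (p : 'I_s -> 'I_m) :
  irreducible_rep c ->
  (forall k, clbase (g k) * clbase (g k) = 1 :> Cl R m) ->
  (forall k l, clbase (g k) * clbase (g l) = clbase (g l) * clbase (g k)
     :> Cl R m) ->
  (forall k l, (p k \in g l) = (k == l)) ->
  (\dim {:V} <= 2 ^ (m - s))%N.
Proof.
move=> [V0 irr] g_sqr g_comm gp.
have [v v0] : exists v : V, v != 0.
  by exists (vpick fullv); rewrite vpick0; apply/eqP.
have [u u0 ug] : exists2 u, u != 0 &
    forall k, exists e : bool, c (clbase (g k)) u = (-1) ^+ e *: u.
  have [|? ?|u u0 us] := @common_eigenvector (codom g) v v0.
  - by move=> _ /codomP[k ->].
  - by move=> /codomP[k ->] /codomP[l ->].
  by exists u => // k; apply: us; apply: codom_f.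
have p_inj : injective p.
  by move=> k l pkl; apply/eqP; rewrite -gp pkl gp.
pose P := p @: setT.
pose X := [seq c (clbase A) u | A <- enum (powerset (~: P))].
(* Induction on the number of pivots in A: replacing u by its multiple by [clbase (g k)] changes A
   into its symmetric difference with g k, which loses the pivot p k and gains none. *)
have X_base A : c (clbase A) u \in <<X>>%VS.
  elim: {A}#|A :&: P| {-2}A (leqnn #|A :&: P|) => [|d IHd] A.
    rewrite leqn0 cards_eq0 setI_eq0 => AP; apply/memv_span/map_f.
    by rewrite mem_enum inE -disjoints_subset.
  move=> le_d; have [AP|[i /setIP[kA /imsetP[k _ kE]]]] := set_0Vmem (A :&: P).
    by apply: IHd; rewrite AP cards0.
  rewrite {i}kE in kA; have [e ue] := ug k.
  have -> : u = (-1) ^+ e *: c (clbase (g k)) u.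
    by rewrite ue scalerA -expr2 sqrr_sign scale1r.
  rewrite (linZ (c_linr _)) -cM clbaseM (linZ (c_linl _)) !rpredZ //.
  apply: IHd; rewrite -ltnS; apply: leq_trans le_d.
  rewrite [X in (_ < X)%N](cardsD1 (p k)) inE kA imset_f //= add1n ltnS.
  apply/subset_leq_card/subsetP => j /setIP[lA /imsetP[l _ lE]].
  rewrite {j}lE in lA *; move: lA; rewrite !inE gp (inj_eq p_inj) imset_f // andbT.
  by case: eqP => [->|_]; rewrite ?addbF // kA.
have X_all x y : y \in <<X>>%VS -> c x y \in <<X>>%VS.
  move=> /(coord_span (X := in_tuple X))->; rewrite (lin_sum (c_linr _)).
  apply: rpred_sum => i _.
  rewrite (linZ (c_linr _)); apply: rpredZ.
  have /mapP[A _ ->] : X`_i \in X by rewrite mem_nth.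
  rewrite -cM [x * _]clbaseE (lin_sum (c_linl _)); apply: rpred_sum => B _.
  by rewrite (linZ (c_linl _)) rpredZ.
have [X0|Xf] := irr <<X>>%VS X_all.
  have := X_base set0; rewrite X0 memv0 (_ : clbase set0 = 1) // c1.
  by rewrite (negbTE u0).
rewrite -Xf; apply: leq_trans (dim_span _) _; rewrite size_map -cardE.
by rewrite card_powerset cardsCs setCK card_ord card_imset // cardsT card_ord.
Qed.

(** The e_A with A among the first q indices act by linearly independent operators: for A nonempty,
    e_A anticommutes with one of the first q generators, so its trace is 0 and the 2^q operators are
    orthogonal for the trace form. *)
Lemma clifford_dim_ge (q : nat) : (0 < \dim {:V})%N -> ~~ odd q -> (q <= m)%N ->
  (2 ^ q <= \dim {:V} ^ 2)%N.
Proof.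
set N := \dim {:V} => N_gt0 q_even q_le.
have [B Bdot] := is_dot_exists V.
have [f [f_on fE]] := orthonormal_basis Bdot.
pose M x : 'M[R]_N := op_mx B f (c x).
have MM x y : M (x * y) = M y *m M x.
  rewrite -(op_mx_comp Bdot fE) //; apply/matrixP => i j; rewrite !mxE /=.
  by rewrite cM.
have Mlin : linear M.
  by move=> a x y; apply/matrixP => i j; rewrite !mxE c_linl is_dot_linear.
have M1 : M 1 = 1%:M.
  by apply/matrixP => i j; rewrite !mxE c1 f_on.
pose Q := [set i : 'I_m | (i < q)%N].
have cardQ : #|Q| = q.
  have -> : Q = [set widen_ord q_le i | i in 'I_q].
    apply/setP => i; rewrite inE; apply/idP/imsetP => [iq|[j _ ->]]; last first.
      exact: ltn_ord j.
    by exists (Ordinal iq) => //; apply: val_inj.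
  by rewrite card_imset ?card_ord // => i j /(congr1 val)/= ij; apply: val_inj.
have trM (A : {set 'I_m}) : A \subset Q -> A != set0 -> \tr (M (clbase A)) = 0.
  move=> AQ A0.
  (* For #|A| odd, i is taken outside A, which is not all of Q since q is even; for #|A| even, i is
     taken in A. *)
  have [i iQ Ai] : exists2 i, i \in Q & odd (#|A| + (i \in A)).
    case oddA: (odd #|A|).
      have : A \proper Q.
        rewrite properE AQ; apply/negP => QA; move: oddA.
        have /eqP -> : A == Q by rewrite eqEsubset AQ.
        by rewrite cardQ (negbTE q_even).
      case/properP=> _ [i iQ iA]; exists i => //.
      by rewrite (negbTE iA) addn0 oddA.
    have [i iA] := set0Pn _ A0; exists i; first exact: (subsetP AQ).
    by rewrite iA addn1 /= oddA.
  apply: (mxtrace_anticomm (y := M (clgen i))).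
    by rewrite -MM clbase_bivector_sqr ?bivector_gen // (linN Mlin) M1.
  rewrite -!MM clbase_comm cards1 mul1n.
  have -> : #|[set i] :&: A| = (i \in A) :> nat.
    have [iA|iA] := boolP (i \in A).
      by have /setIidPl -> : [set i] \subset A; rewrite ?sub1set ?cards1.
    by apply/eqP; rewrite cards_eq0 setI_eq0 disjoints1.
  by rewrite Ai (linZ Mlin) scaleN1r.
pose e (i : 'I_#|powerset Q|) := enum_val i.
have eQ i : e i \subset Q by have := enum_valP i; rewrite powersetE.
pose X := [tuple M (clbase (e i)) | i < #|powerset Q|].
have /eqP fX : free X.
  apply/freeP => t t0 i; have := congr1 (fun x => \tr (x *m M (clbase (e i)))) t0.
  rewrite mul0mx mxtrace0 mulmx_suml raddf_sum (bigD1 i) //= big1 => [|j neji].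
    rewrite nth_mktuple -scalemxAl mxtraceZ addr0 -MM clbase_sqr (linZ Mlin) M1.
    rewrite mxtraceZ mxtrace1 => /eqP; rewrite !mulf_eq0 signr_eq0 pnatr_eq0.
    by rewrite -leqn0 leqNgt N_gt0 !orbF => /eqP.
  rewrite nth_mktuple -scalemxAl mxtraceZ -MM clbaseM (linZ Mlin) mxtraceZ.
  rewrite trM ?mulr0 //.
    apply/subsetP => k; rewrite inE.
    have := subsetP (eQ i) k; have := subsetP (eQ j) k.
    by do 2!case: (k \in _) => //=; auto.
  apply: contra neji => /eqP/setP ij; apply/eqP/enum_val_inj/setP => k.
  by have := ij k; rewrite !inE; do 2!case: (k \in _).
have : (size X <= \dim {:'M[R]_N})%N by rewrite -fX dimvS ?subvf.
by rewrite dimvf dim_matrix size_tuple card_powerset cardQ.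
Qed.

End CliffordDimension.

(** * The extended spin algebras *)

Section PairCounting.
Local Open Scope ring_scope.
Variables (R : realType) (n : nat).
Implicit Types (A B E F : {set 'I_n}).

Lemma sum_pairs (f : {set 'I_n} -> R) :
  \sum_i \sum_(j | j != i) f [set i; j] = (\sum_(A : {set 'I_n} | #|A| == 2) f A) *+ 2.
Proof.
rewrite (pair_big_dep xpredT (fun i j => j != i) (fun i j => f [set i; j])) /=.
rewrite (partition_big (fun p => [set p.1; p.2])
  (fun A : {set 'I_n} => #|A| == 2)); last first.
  by case=> i j /= neji; rewrite cards2 (eq_sym i) neji.
rewrite -sumrMnl; apply: eq_bigr => A /cards2P[a [b [neab AE]]].
rewrite (bigD1 (a, b)) /= ?AE ?eqxx ?andbT 1?eq_sym // (bigD1 (b, a)) /=; last first.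
  by rewrite setUC eqxx neab xpair_eqE negb_and eq_sym neab.
rewrite big1 ?addr0 ?mulr2n => [|[i j] /=]; first by rewrite [X in _ + f X]setUC.
rewrite !xpair_eqE => /andP[/andP[/andP[neji /eqP/setP eA] n1] n2].
have := eA i; have := eA j; rewrite !inE !eqxx /= orbT.
move=> /esym/orP[]/eqP ej /esym/orP[]/eqP ei;
  by move: neji n1 n2; rewrite ei ej !eqxx.
Qed.

Lemma card_pairI (i j : 'I_n) B : j != i ->
  #|[set i; j] :&: B| = ((i \in B) + (j \in B))%N.
Proof.
move=> neji; rewrite setIUl cardsU.
have c1 k : #|[set k] :&: B| = (k \in B).
  have [kB|kB] := boolP (k \in B).
    by have /setIidPl -> : [set k] \subset B; rewrite ?sub1set ?cards1.
  by apply/eqP; rewrite cards_eq0 setI_eq0 disjoints1.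
rewrite !c1 (_ : _ :&: _ = set0) ?cards0 ?subn0 //.
apply/setP => k; rewrite !inE; case: eqP => [->|] //=.
by rewrite eq_sym (negbTE neji) !andbF.
Qed.

(* With x_i = (-1)^[i \in B], twice the sum is (\sum x_i)^2 - \sum x_i^2. *)
Lemma sum_sign_pairs B : #|B| = 2 ->
  (\sum_(A : {set 'I_n} | #|A| == 2) (-1) ^+ odd #|A :&: B|) *+ 2 =
  (n%:R - 4) ^+ 2 - n%:R :> R.
Proof.
move=> B2; rewrite -sum_pairs.
pose x i : R := (-1) ^+ (i \in B).
have -> : n%:R - 4 = \sum_i x i.
  rewrite (bigID (fun i => i \in B)) /= (eq_bigr (fun=> -1)) => [|i iB]; last first.
    by rewrite /x iB.
  rewrite [X in _ = _ + X](eq_bigr (fun=> 1)) => [|i /negbTE iB]; last by rewrite /x iB.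
  rewrite !sumr_const B2.
  have /(congr1 (fun k => k%:R : R)) := cardsC B; rewrite B2 card_ord natrD => <-.
  have -> : #|[pred i | i \notin B]| = #|~: B| by apply: eq_card => i; rewrite !inE.
  by rewrite mulNrn; ring.
rewrite expr2 mulr_suml -[X in _ - X%:R]card_ord -sum1_card natr_sum -sumrB.
apply: eq_bigr => i _; rewrite mulr_sumr [in RHS](bigD1 i) //= -expr2 sqrr_sign.
rewrite addrAC subrr add0r; apply: eq_bigr => j neji.
by rewrite card_pairI // signr_odd exprD.
Qed.

Lemma sum_pairs1 :
  (\sum_(A : {set 'I_n} | #|A| == 2) 1) *+ 2 = n%:R * (n%:R - 1) :> R.
Proof.
rewrite -(sum_pairs (fun=> 1)) (eq_bigr (fun=> n%:R - 1)) => [|i _].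
  by rewrite sumr_const card_ord mulr_natl.
rewrite -[X in X%:R - 1]card_ord -sum1_card natr_sum [in RHS](bigD1 i) //=.
by rewrite addrAC subrr add0r.
Qed.

(** The pair consists of an element of E and one outside both sets. *)
Lemma separating_pair E F : #|E| = 2 -> [disjoint E & F] -> (#|E| + #|F| < n)%N ->
  exists A, [/\ #|A| = 2, #|A :&: E| = 1%N & #|A :&: F| = 0%N].
Proof.
move=> E2 EF lt_n.
have [i iE] : exists i, i \in E by apply/set0Pn; rewrite -card_gt0 E2.
have [p pEF] : exists p, p \notin E :|: F.
  apply/existsP; rewrite -negb_forall; apply: contraL lt_n => /forallP all_in.
  rewrite -leqNgt -[X in (X <= _)%N]card_ord -cardsT.
  apply: leq_trans (leq_card_setU E F).
  by apply/subset_leq_card/subsetP => k _; apply: all_in.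
move: pEF; rewrite inE negb_or => /andP[pE pF].
have neip : i != p by apply: contraNneq pE => <-.
have iF : i \notin F by move: EF; rewrite disjoint_sym => /disjointFl->.
exists [set p; i]; rewrite !card_pairI // cards2 eq_sym neip.
by rewrite iE (negbTE pE) (negbTE pF) (negbTE iF).
Qed.

End PairCounting.

Section SpinSums.
Local Open Scope ring_scope.
Variables (R : realType) (m : nat).
Implicit Types (A B : {set 'I_m}).

Lemma sum_bivectors (F : {set 'I_m.+1} -> R) :
  \sum_(A | is_bivector A) F (even_set A) =
  \sum_(A : {set 'I_m.+1} | #|A| == 2) F A.
Proof.
rewrite [RHS](reindex_onto (@even_set m)
  (fun A : {set 'I_m.+1} => lift ord_max @^-1: A)) => [|A /eqP A2].
  by apply: eq_bigl => A; rewrite even_setK eqxx andbT.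
by rewrite even_setE ?A2.
Qed.

Lemma is_bivector_preim (A : {set 'I_m.+1}) :
  #|A| = 2 -> is_bivector (lift ord_max @^-1: A).
Proof. by move=> A2; rewrite /is_bivector even_setE A2. Qed.

Definition bivector_index := {A : {set 'I_m} | is_bivector A}.

Definition spin_anti k (i j : bivector_index + 'I_k) : bool :=
  match i, j with
  | inl A, inl B => odd #|even_set (val A) :&: even_set (val B)|
  | inr s, inr t => s != t
  | _, _ => false
  end.

Lemma bivectorP (A : bivector_index) : is_bivector (val A).
Proof. exact: (valP A). Qed.

Lemma bivector_pair (A : bivector_index) : #|even_set (val A)| = 2.
Proof. exact/eqP/(valP A). Qed.

Lemma spin_anti_sym k : symmetric (@spin_anti k).
Proof. by case=> [A|s] [B|t] //=; [rewrite setIC|rewrite eq_sym]. Qed.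

Lemma bivector_disjoint (A B : bivector_index) :
  ~~ odd #|even_set (val A) :&: even_set (val B)| -> A != B ->
  [disjoint even_set (val A) & even_set (val B)].
Proof.
move=> eAB neAB; rewrite -setI_eq0 -cards_eq0; move: eAB.
have := subset_leq_card (subsetIl (even_set (val A)) (even_set (val B))).
rewrite bivector_pair; case cI: #|_| => [|[|[|]]] // _ _.
have eAB : even_set (val A) = even_set (val B).
  transitivity (even_set (val A) :&: even_set (val B)); apply/eqP.
    by rewrite eq_sym eqEcard subsetIl bivector_pair cI.
  by rewrite eqEcard subsetIr bivector_pair cI.
case/negP: neAB; apply/eqP/val_inj.
by rewrite -[LHS]even_setK eAB even_setK.
Qed.

(** Two anticommuting elements are separated by one of them. Two bivectors with disjoint pairs are
    separated by an index of the first joined to a fifth index, available since n = m + 1 >= 5. *)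
Lemma spin_anti_sep k (i j : bivector_index + 'I_k) : (4 <= m)%N -> i != j ->
  exists l, spin_anti l i (+) spin_anti l j.
Proof.
move=> m4.
have sep (A : bivector_index) (F : {set 'I_m.+1}) : [disjoint even_set (val A) & F] ->
    (#|F| <= 2)%N -> exists B : bivector_index,
    odd #|even_set (val B) :&: even_set (val A)| /\
    ~~ odd #|even_set (val B) :&: F|.
  move=> AF F2; have [|Y [Y2 YA YF]] := @separating_pair _ _ F (bivector_pair A) AF.
    by rewrite bivector_pair; apply: leq_ltn_trans (leq_add (leqnn 2) F2) _.
  exists (Sub (lift ord_max @^-1: Y) (is_bivector_preim Y2)).
  by rewrite SubK even_setE ?Y2 // YA YF.
have sep0 (A : bivector_index) : exists B : bivector_index,
    odd #|even_set (val B) :&: even_set (val A)|.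
  by have [||B []] := sep A set0; rewrite ?cards0 -?setI_eq0 ?setI0 //; exists B.
case: i j => [A|s] [B|t] neij.
- have [oAB|eAB] := boolP (odd #|even_set (val A) :&: even_set (val B)|).
    by exists (inl B); rewrite /= setIid bivector_pair setIC oAB.
  have [|/=|C [CA CB]] := sep A (even_set (val B)); last first.
  + by exists (inl C); rewrite /= CA (negbTE CB).
  + by rewrite bivector_pair.
  by apply: bivector_disjoint => //; apply: contra neij => /eqP->.
- by have [B AB] := sep0 A; exists (inl B); rewrite /= AB.
- by have [A AB] := sep0 B; exists (inl A); rewrite /= AB.
by exists (inr s); rewrite /= eqxx; apply: contra neij => /eqP->.
Qed.

End SpinSums.

Section SpinWeights.
Local Open Scope ring_scope.
Variables (R : realType) (m k : nat) (w : bivector_index m + 'I_k -> R).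
Variables (l u : R).
Hypotheses (wl : forall A, w (inl A) = l) (wr : forall s, w (inr s) = u).
Let n : R := m.+1%:R.

Lemma spin_weights_inl A :
  (\sum_i w i * (-1) ^+ spin_anti i (inl A)) *+ 2 =
  l * ((n - 4) ^+ 2 - n) + 2 * k%:R * u.
Proof.
rewrite big_sumType /= mulrnDl; congr (_ + _).
  under eq_bigr => B _ do rewrite wl.
  rewrite -mulr_sumr -mulrnAr; congr (_ * _).
  rewrite -(sum_sign_pairs R (bivector_pair A)).
  rewrite -(sum_bivectors (fun B => (-1) ^+ odd #|B :&: even_set (val A)|)).
  congr (_ *+ 2); exact/esym/(big_sub (@is_bivector m)
    (fun B => (-1) ^+ odd #|even_set B :&: even_set (val A)|)).
under eq_bigr => s _ do rewrite wr mulr1.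
by rewrite sumr_const card_ord -mulr_natr -[u *+ k]mulr_natr; ring.
Qed.

(** The unit t commutes with the bivectors and with itself and anticommutes with the k - 1 other
    units, hence the term 2 u (1 - (k - 1)). *)
Lemma spin_weights_inr t :
  (\sum_i w i * (-1) ^+ spin_anti i (inr t)) *+ 2 =
  l * (n * (n - 1)) + u * (4 - 2 * k%:R).
Proof.
rewrite big_sumType /= mulrnDl; congr (_ + _).
  under eq_bigr => B _ do rewrite wl.
  rewrite -mulr_sumr -mulrnAr; congr (_ * _).
  rewrite -(sum_pairs1 R m.+1) -(sum_bivectors (fun=> 1)).
  congr (_ *+ 2); exact/esym/(big_sub (@is_bivector m) (fun=> 1)).
rewrite (bigD1 t) //= eqxx wr mulr1.
rewrite (eq_bigr (fun=> - u)) => [|s nest]; last by rewrite wr nest mulrN1.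
rewrite sumr_const -mulr_natr.
have := cardC1 t; rewrite card_ord => ->.
have k_gt0 : (0 < k)%N by apply: leq_ltn_trans (ltn_ord t).
by rewrite -[in k%:R](prednK k_gt0) -[_ *+ k.-1]mulr_natr -[in RHS]natr1; ring.
Qed.

End SpinWeights.

(* [Z] lists the imaginary units of the commutant. *)
Record spin_extension (R : realType) (m : nat) (V : vectType R)
    (c : Cl R m -> V -> V) (h : lieAlg R) (rho : h -> V -> V)
    (iota : lie_spin R m.+1 -> h) (k : nat) (Z : 'I_k -> h) : Prop :=
  SpinExtension {
  se_bilinear : bilinear_for *:%R *:%R rho;
  se_hom : forall x y v,
    rho (lbr x y) v = (rho x (rho y v) - rho y (rho x v))%R;
  se_iota_linear : linear iota;
  se_iota : forall a v, rho (iota a) v = c (vsval a) v;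
  se_sqr : forall s v, rho (Z s) (rho (Z s) v) = (- v)%R;
  se_anti : forall s t v, s != t ->
    rho (Z s) (rho (Z t) v) = (- rho (Z t) (rho (Z s) v))%R;
  se_comm : forall s a v,
    rho (Z s) (rho (iota a) v) = rho (iota a) (rho (Z s) v);
  se_span : forall x, exists a (q : 'I_k -> R),
    x = (iota a + \sum_s q s *: Z s)%R }.

Section SpinExtension.
Local Open Scope ring_scope.
Variables (R : realType) (m : nat) (V : vectType R) (c : Cl R m -> V -> V).
Variables (h : lieAlg R) (rho : h -> V -> V).
Variables (iota : lie_spin R m.+1 -> h) (k : nat) (Z : 'I_k -> h).
Hypotheses (m4 : (4 <= m)%N) (V_gt0 : (0 < \dim {:V})%N).
Hypotheses (c_alg : algebra_rep c) (se : spin_extension c rho iota Z).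

Let N : R := (\dim {:V})%:R.
Let n : R := m.+1%:R.

Definition spin_basis (i : bivector_index m + 'I_k) : h :=
  match i with
  | inl A => iota (vsproj _ (clbase (val A)))
  | inr s => Z s
  end.

Lemma spin_clifford_basis : clifford_basis rho spin_basis (@spin_anti m k).
Proof.
have [[c_linl c_linr] c1 cM] := c_alg.
have [rho_bil rho_hom iota_lin rho_iota Z_sqr Z_anti Z_comm h_span] := se.
have XE (A : bivector_index m) v :
    rho (spin_basis (inl A)) v = c (clbase (val A)) v.
  by rewrite /= rho_iota vsprojK // spin_space_base // bivectorP.
split=> //.
- move=> x; have [a [q ->]] := h_span x.
  have aE : a = \sum_(A : bivector_index m) vsval a (val A) *:
      vsproj (spin_space R m.+1) (clbase (val A)).
    apply: subvs_inj; rewrite linear_sum /= {1}(spin_spaceE (subvsP a)).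
    rewrite (big_sub (@is_bivector m) (fun A => vsval a A *: clbase A)).
    apply: eq_bigr => A _; rewrite ?linearZ /= vsprojK //.
    by rewrite spin_space_base // bivectorP.
  exists (fun i => match i with inl A => vsval a (val A) | inr s => q s end).
  rewrite big_sumType /= {1}aE (lin_sum iota_lin); congr (_ + _).
  by apply: eq_bigr => A _; rewrite (linZ iota_lin).
- case=> [A|s] v; last exact: Z_sqr.
  rewrite !XE -cM clbase_bivector_sqr ?bivectorP //.
  by rewrite (linN (c_linl v)) c1.
- case=> [A|s] [B|t] v.
  + by rewrite !XE -!cM clbase_comm odd_even_setI (linZ (c_linl v)).
  + by rewrite scale1r -Z_comm.
  + by rewrite scale1r Z_comm.
  have [->|nest] := eqVneq s t; first by rewrite /= eqxx scale1r.
  by rewrite /= nest scaleN1r Z_anti.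
- exact: spin_anti_sym.
by move=> i j; apply: spin_anti_sep.
Qed.

Lemma spin_lie_type_equations : of_lie_type rho -> exists l u : R,
  [/\ 0 < l, 0 < u, N * l = l * ((n - 4) ^+ 2 - n) + 2 * k%:R * u &
      (0 < k)%N -> u * (N + 2 * k%:R - 4) = l * (n * (n - 1))].
Proof.
case/(weights_of_lie_type spin_clifford_basis) => w [w_gt0 w_anti wE].
(* Bivectors with disjoint pairs are linked by a third one, whose pair meets each of theirs once. *)
have wl (A B : bivector_index m) : w (inl A) = w (inl B).
  have [->//|neAB] := eqVneq A B.
  have [oAB|eAB] := boolP (odd #|even_set (val A) :&: even_set (val B)|).
    exact: w_anti.
  have AB := bivector_disjoint eAB neAB.
  have pick_in (C : bivector_index m) : exists i, i \in even_set (val C).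
    by apply/set0Pn; rewrite -card_gt0 bivector_pair.
  have [i iA] := pick_in A; have [j jB] := pick_in B.
  have iB : (i \in even_set (val B)) = false by apply: (disjointFr AB).
  have jA : (j \in even_set (val A)) = false by apply: (disjointFl AB).
  have neij : i != j by apply: contraFneq iB => ->.
  have ij2 : #|[set i; j]| = 2 by rewrite cards2 neij.
  pose C : bivector_index m :=
    Sub (lift ord_max @^-1: [set i; j]) (is_bivector_preim ij2).
  have CE : even_set (val C) = [set i; j] by rewrite SubK even_setE ?ij2.
  rewrite (@w_anti (inl A) (inl C)) ?(@w_anti (inl C) (inl B)) //.
    by rewrite /= CE card_pairI ?iB ?jB // eq_sym.
  by rewrite /= CE setIC card_pairI ?iA ?jA // eq_sym.
have A0 : bivector_index m.
  exact: (Sub [set Ordinal (leq_trans (ltn0Sn 3) m4)] (bivector_gen _)).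
have wr : exists2 u : R, 0 < u & forall s, w (inr s) = u.
  case: (posnP k) => [k0|k_gt0].
    (* Without units, u is set to 1. *)
    by exists 1 => // s; have := ltn_ord s; rewrite {2}k0.
  exists (w (inr (Ordinal k_gt0))) => // s.
  have [->//|nes] := eqVneq s (Ordinal k_gt0).
  exact: w_anti.
have [u u_gt0 wu] := wr; exists (w (inl A0)), u; split=> // [|k_gt0].
  by rewrite wE (@spin_weights_inl _ _ _ w (w (inl A0)) u) // => A; apply: wl.
have := wE (inr (Ordinal k_gt0)).
rewrite (@spin_weights_inr _ _ _ w (w (inl A0)) u) //.
by rewrite wu /N /n; lra.
Qed.

Lemma spin_lie_type_inequations (u : R) : 0 < u ->
  N <= (n - 4) ^+ 2 - n + 2 * k%:R * u ->
  ((0 < k)%N -> u * (N + 2 * k%:R - 4) <= n * (n - 1)) ->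
  of_lie_type rho.
Proof.
move=> u_gt0 le1 le2.
pose w (i : bivector_index m + 'I_k) : R := if i is inl _ then 1 else u.
apply: (lie_type_of_weights spin_clifford_basis (w := w)).
- by case.
- by case=> [A|s] [B|t].
case=> [A|t].
  rewrite (@spin_weights_inl _ _ _ w 1 u) //; move: le1; rewrite /N /n /=; lra.
rewrite (@spin_weights_inr _ _ _ w 1 u) //.
have k_gt0 : (0 < k)%N by apply: leq_ltn_trans (ltn_ord t).
have := le2 k_gt0; rewrite /N /n /=; lra.
Qed.

End SpinExtension.

(** * The real, complex and quaternionic types as spin extensions *)

Section SpinExtInstances.
Local Open Scope ring_scope.
Variables (R : realType) (m : nat) (V : vectType R) (c : Cl R m -> V -> V).
Hypothesis c_alg : algebra_rep c.

Let c_linl v : linear (c^~ v). Proof. by have [[H _] _ _] := c_alg; apply: H. Qed.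
Let c_linr x : linear (c x). Proof. by have [[_ H] _ _] := c_alg; apply: H. Qed.
Let cM x y v : c (x * y) v = c x (c y v).
Proof. by have [_ _ H] := c_alg; apply: H. Qed.

Lemma clifford_hom (a b : lie_spin R m.+1) v : c (vsval (lbr a b)) v =
  c (vsval a) (c (vsval b) v) - c (vsval b) (c (vsval a) v).
Proof.
rewrite vsprojK; last exact: spin_comm (subvsP a) (subvsP b).
by rewrite /cl_comm (linB (c_linl v)) !cM.
Qed.

Lemma spin_extension_real (rho : lie_spin R m.+1 -> V -> V) :
  (forall a v, rho a v = c (vsval a) v) ->
  spin_extension c rho idfun (fun _ : 'I_0 => 0).
Proof.
move=> rhoE; split=> // [|x y v|[]//|[]//|[]//|x].
- by split=> u a x y; rewrite !rhoE ?linearP ?c_linl ?c_linr.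
- by rewrite !rhoE clifford_hom.
by exists x, (fun=> 0); rewrite big_ord0 addr0.
Qed.

(** Common to the complex and quaternionic types: the second summand acts through a representation
    [kappa] that commutes with spin(m + 1). *)
Lemma spin_extension_dsum (g : lieAlg R) (kappa : g -> V -> V)
    (rho : lie_dsum (lie_spin R m.+1) g -> V -> V) (k : nat) (z : 'I_k -> g) :
  (forall a q v, rho (a, q) v = c (vsval a) v + kappa q v) ->
  bilinear_for *:%R *:%R kappa ->
  (forall p q v, kappa (lbr p q) v = kappa p (kappa q v) - kappa q (kappa p v)) ->
  (forall q (a : lie_spin R m.+1) v,
     kappa q (c (vsval a) v) = c (vsval a) (kappa q v)) ->
  (forall s v, kappa (z s) (kappa (z s) v) = - v) ->
  (forall s t v, s != t ->
     kappa (z s) (kappa (z t) v) = - kappa (z t) (kappa (z s) v)) ->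
  (forall q, exists x : 'I_k -> R, q = \sum_s x s *: z s) ->
  spin_extension c rho (fun a => (a, 0)) (fun s => (0, z s)).
Proof.
move=> rhoE [kap_linl kap_linr] kap_hom kap_comm z_sqr z_anti z_span.
have kap0 v : kappa 0 v = 0 := lin0 (kap_linl v).
have c0 v : c 0 v = 0 := lin0 (c_linl v).
have rho0 q v : rho (0, q) v = kappa q v by rewrite rhoE linear0 c0 add0r.
have rho1 a v : rho (a, 0) v = c (vsval a) v by rewrite rhoE kap0 addr0.
split=> [|x y v|a u v|//|s v|s t v nest|s a v|[a q]].
- split=> [v a [x p] [y q]|[x p] a u v] /=.
    by rewrite !rhoE linearP c_linl kap_linl scalerDr addrACA.
  by rewrite !rhoE c_linr kap_linr scalerDr addrACA.
- case: x y => [a p] [b q].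
  rewrite [lbr _ _](_ : _ = (lbr a b, lbr p q)) // !rhoE clifford_hom kap_hom.
  rewrite !(linD (c_linr _)) !(linD (kap_linr _)) !kap_comm.
  have shuffle (x y s t p' q' : V) :
      x - y + (p' - q') = x + s + (t + p') - (y + t + (s + q')).
    rewrite (addrC t) (addrACA x s) (addrC s q') (addrACA y t) (addrC t).
    by rewrite [in RHS]opprD (addrACA (x + p')) subrr addr0 opprD addrACA.
  exact: shuffle.
- by apply: injective_projections; rewrite /= ?scaler0 ?addr0.
- by rewrite !rho0 z_sqr.
- by rewrite !rho0 z_anti.
- by rewrite rho0 !rho1 rho0 kap_comm.
have [x ->] := z_span q; exists a, x.
have fstS : (\sum_s x s *: ((0, z s) : lie_dsum (lie_spin R m.+1) g)).1 = 0.
  by rewrite (raddf_sum fst) big1 // => s _; rewrite /= scaler0.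
have sndS : (\sum_s x s *: ((0, z s) : lie_dsum (lie_spin R m.+1) g)).2 =
    \sum_s x s *: z s.
  by rewrite (raddf_sum snd).
by apply: injective_projections; rewrite /= ?fstS ?sndS ?addr0 ?add0r.
Qed.

Section Structures.
Variable sigma : lie_spin R m.+1 -> V -> V.
Hypothesis sigmaE : forall a v, sigma a v = c (vsval a) v.

Lemma spin_extension_complex
    (rho : lie_dsum (lie_spin R m.+1) (lie_u1 R) -> V -> V) (J : 'End(V)) :
  complex_structure sigma J ->
  (forall a (z : R) v, rho (a, z) v = sigma a v + z *: J v) ->
  spin_extension c rho (fun a => (a, 0)) (fun _ : 'I_1 => (0, 1 : R^o)).
Proof.
move=> [J_comm J_sqr] rhoE.
apply: (@spin_extension_dsum (lie_u1 R) (fun q v => q *: J v)) => //.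
- by move=> a q v; rewrite rhoE sigmaE.
- split=> [v a p q|p a u v]; first by rewrite /= scalerDl (scalerA a p).
  by rewrite /= linearP scalerDr !scalerA mulrC.
- by move=> p q v; rewrite /= scale0r !linearZ /= !scalerN subrr.
- by move=> q a v; rewrite (linZ (c_linr _)) -!sigmaE J_comm.
- by move=> s v; rewrite !scale1r J_sqr.
- by move=> s t v; rewrite !ord1 eqxx.
by move=> q; exists (fun=> q); rewrite big_ord1 /GRing.scale /= mulr1.
Qed.

Lemma spin_extension_quaternionic
    (rho : lie_dsum (lie_spin R m.+1) (lie_sp1 R) -> V -> V) (I J : 'End(V)) :
  quaternionic_structure sigma I J ->
  (forall a (q : 'rV[R]_3) v, rho (a, q) v =
     sigma a v + (q 0 0 *: I v + q 0 1 *: J v + q 0 2 *: I (J v))) ->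
  spin_extension c rho (fun a => (a, 0))
    (fun s : 'I_3 => (0, delta_mx 0 s : 'rV[R]_3)).
Proof.
move=> [[I_comm I_sqr] [J_comm J_sqr] IJ] rhoE.
pose kappa (q : lie_sp1 R) v : V := let q := q : 'rV[R]_3 in
  q 0 0 *: I v + q 0 1 *: J v + q 0 2 *: I (J v).
have JI v : J (I v) = - I (J v) by rewrite IJ opprK.
have ID u v : I (u + v) = I u + I v by apply: linearD.
have JD u v : J (u + v) = J u + J v by apply: linearD.
have IZ a u : I (a *: u) = a *: I u by apply: linearZ_LR.
have JZ a u : J (a *: u) = a *: J u by apply: linearZ_LR.
have IN u : I (- u) = - I u by apply: linearN.
have JN u : J (- u) = - J u by apply: linearN.
have EL := (ID, JD, IZ, JZ, IN, JN).
have [B Bdot] := is_dot_exists V.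
have BE := (dotDl Bdot, dotNl Bdot, dotZl Bdot).
have three (P : 'I_3 -> Prop) : P 0 -> P 1 -> P 2 -> forall s, P s.
  move=> P0 P1 P2 [[|[|[|//]]] lt3].
  - by rewrite (_ : Ordinal lt3 = 0) //; apply: val_inj.
  - by rewrite (_ : Ordinal lt3 = 1) //; apply: val_inj.
  - by rewrite (_ : Ordinal lt3 = 2) //; apply: val_inj.
have kap0 v : kappa (delta_mx 0 0 : 'rV[R]_3) v = I v.
  by rewrite /kappa !mxE /= scale1r !scale0r !addr0.
have kap1 v : kappa (delta_mx 0 1 : 'rV[R]_3) v = J v.
  by rewrite /kappa !mxE /= scale1r !scale0r addr0 add0r.
have kap2 v : kappa (delta_mx 0 2 : 'rV[R]_3) v = I (J v).
  by rewrite /kappa !mxE /= scale1r !scale0r !add0r.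
apply: (@spin_extension_dsum (lie_sp1 R) kappa) => //.
- by move=> a q v; rewrite rhoE sigmaE.
- split=> [v a p q|p a u v]; apply: (dot_inj Bdot) => x; rewrite /kappa /=.
    by rewrite !mxE !BE; ring.
  by rewrite !linearP !BE; ring.
- move=> p q v; apply: (dot_inj Bdot) => x; rewrite /kappa /=.
  rewrite !EL !(JI, I_sqr, J_sqr) !EL !(I_sqr, J_sqr) !mxE.
  rewrite !BE.
  have -> : 0 + 1 = 1 :> 'I_3 by apply: val_inj.
  have -> : 0 + 2 = 2 :> 'I_3 by apply: val_inj.
  have -> : 1 + 1 = 2 :> 'I_3 by apply: val_inj.
  have -> : 1 + 2 = 0 :> 'I_3 by apply: val_inj.
  have -> : 2 + 1 = 0 :> 'I_3 by apply: val_inj.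
  have -> : 2 + 2 = 1 :> 'I_3 by apply: val_inj.
  by ring.
- move=> q a v; rewrite /kappa /= !(linD (c_linr _), linZ (c_linr _)) -!sigmaE.
  by rewrite -!I_comm -!J_comm.
- elim/three => v; rewrite ?kap0 ?kap1 ?kap2 ?I_sqr ?J_sqr //.
  by rewrite JI linearN /= I_sqr opprK J_sqr.
- elim/three; elim/three => v; rewrite ?eqxx // => _; rewrite ?kap0 ?kap1 ?kap2 //;
    by rewrite !(JI, IN, JN, I_sqr, J_sqr, opprK).
move=> q; exists (fun s => (q : 'rV[R]_3) 0 s); exact: row_sum_delta.
Qed.

End Structures.
End SpinExtInstances.

(** * Doubly even codes and spinor dimensions *)

Section Codes.
Variables (R : realType) (m : nat).

Definition word_set (l : seq nat) : {set 'I_m} := [set i | val i \in l].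

Lemma card_ord_set (P : pred nat) :
  #|[set i : 'I_m | P (val i)]| = count P (iota 0 m).
Proof. by rewrite cardsE cardE size_filter -val_enum_ord count_map enumT. Qed.

(* [g] lists the words of a code, coordinates [>= m] being discarded, and
   [p] one pivot for each word. *)
Definition isotropic_code (g : seq (seq nat)) (p : seq nat) : bool :=
  let dot a b := count (fun i => (i \in a) && (i \in b)) (iota 0 m) in
  [&& size g == size p, all (fun i => i < m) p,
      all (fun k => all (fun l =>
        (nth 0 p k \in nth [::] g l) == (k == l)) (iota 0 (size p)))
        (iota 0 (size p)),
      all (fun a => ~~ odd (((dot a a).+1 * dot a a)./2)) g &
      all2rel (fun a b => ~~ odd (dot a a * dot b b + dot a b)) g].

(** The two parity tests of the code are on the exponents of the signs in [clbase_sqr] and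
    [clbase_comm]. *)
Lemma isotropic_code_dim_le (V : vectType R) (c : Cl R m -> V -> V) g p :
  irreducible_algebra_rep c -> isotropic_code g p ->
  \dim {:V} <= 2 ^ (m - size p).
Proof.
case=> c_alg c_irr /and5P[/eqP sgp /allP p_lt /allP piv /allP g_sqr].
move=> /allrelP g_comm.
have gI a b : #|word_set a :&: word_set b| =
    count (fun i => (i \in a) && (i \in b)) (iota 0 m).
  by rewrite -card_ord_set; apply: eq_card => i; rewrite !inE.
have gC a : #|word_set a| = count (fun i => (i \in a) && (i \in a)) (iota 0 m).
  by rewrite -gI setIid.
have pk_lt (k : 'I_(size p)) : nth 0 p k < m by rewrite p_lt ?mem_nth.
have gk (k : 'I_(size p)) : nth [::] g k \in g by rewrite mem_nth ?sgp.
apply: (irreducible_clifford_le_dim c_alg (g := fun k => word_set (nth [::] g k))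
  (p := fun k => Ordinal (pk_lt k)) c_irr).
- move=> k; rewrite clbase_sqr bin2 /= gC (negbTE (g_sqr _ (gk k))).
  by rewrite scale1r.
- move=> k l; rewrite clbase_comm gI !gC (negbTE (g_comm _ _ (gk k) (gk l))).
  by rewrite scale1r.
move=> k l; rewrite inE /=; have := piv k; rewrite mem_iota => /(_ (ltn_ord k)).
by move=> /allP/(_ l); rewrite mem_iota => /(_ (ltn_ord l))/eqP.
Qed.

End Codes.

(** The rows of the generator matrix (I | J - I) of the extended Hamming code of length 8, J being
    the all-ones matrix; the first four coordinates serve as pivots. *)
Definition e8_words := [:: [:: 0; 5; 6; 7]; [:: 1; 4; 6; 7]; [:: 2; 4; 5; 7];
  [:: 3; 4; 5; 6]].

Definition e8e8_words := e8_words ++ map (map (addn 8)) e8_words.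

(* The words of the even subcode of the code d_(2k) generated by the pairs
   {2i, 2i + 1}. *)
Definition d_words k :=
  [seq [:: i.*2; i.*2.+1; k.-1.*2; k.-1.*2.+1] | i <- iota 0 k.-1].
Definition d_pivots k := [seq i.*2 | i <- iota 0 k.-1].

Section SpinorDimension.
Variables (R : realType) (V : vectType R).

(** Each case has a code of length at most m + 1; the Hamming code of length 8 serves for m = 7, 8
    and 9. *)
Lemma spinor_dim_le (m d : nat) (c : Cl R m -> V -> V) :
  irreducible_algebra_rep c ->
  (m, d) \in [:: (4, 8); (5, 8); (7, 8); (8, 16); (9, 32); (11, 64); (15, 128)] ->
  \dim {:V} <= d.
Proof.
have code g p m' (c' : Cl R m' -> V -> V) : irreducible_algebra_rep c' ->
    isotropic_code m' g p -> \dim {:V} <= 2 ^ (m' - size p).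
  exact: isotropic_code_dim_le.
move=> irr; rewrite !inE !xpair_eqE.
do ![case/orP] => /andP[/eqP me /eqP->]; subst m.
- exact: (code (d_words 2) (d_pivots 2) _ _ irr).
- exact: (code (d_words 3) (d_pivots 3) _ _ irr).
- exact: (code e8_words (iota 0 4) _ _ irr).
- exact: (code e8_words (iota 0 4) _ _ irr).
- exact: (code e8_words (iota 0 4) _ _ irr).
- exact: (code (d_words 6) (d_pivots 6) _ _ irr).
exact: (code e8e8_words (iota 0 4 ++ iota 8 4) _ _ irr).
Qed.

Lemma spinor_dim_ge (m : nat) (c : Cl R m -> V -> V) :
  irreducible_algebra_rep c -> 2 ^ m./2.*2 <= \dim {:V} ^ 2.
Proof.
case=> c_alg [V0 _]; apply: (clifford_dim_ge c_alg).
- by rewrite lt0n dimv_eq0; apply/eqP.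
- by rewrite odd_double.
by rewrite -[leqRHS]odd_double_half leq_addl.
Qed.

End SpinorDimension.

(** * Lie type in terms of the numbers N, n and k *)

Definition ext_rank (t : rep_type) : nat :=
  match t with RealType => 0 | ComplexType => 1 | QuaternionicType => 3 end.

Section SpinExtLieType.
Local Open Scope ring_scope.
Variables (R : realType) (m : nat) (V : vectType R) (t : rep_type).
Variables (sigma : lie_spin R m.+1 -> V -> V) (c : Cl R m -> V -> V).
Variable rho : spin_ext R m.+1 t -> V -> V.
Hypotheses (m4 : (4 <= m)%N) (c_irr : irreducible_algebra_rep c).
Hypothesis sigmaE : forall a v, sigma a v = c (vsval a) v.
Hypothesis rhoP : spin_ext_action sigma rho.

Let N : R := (\dim {:V})%:R.
Let n : R := m.+1%:R.
Let k := ext_rank t.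

Let V_gt0 : (0 < \dim {:V})%N.
Proof. by have [_ [V0 _]] := c_irr; rewrite lt0n dimv_eq0; apply/eqP. Qed.

Lemma spin_ext_extension : exists iota (Z : 'I_k -> spin_ext R m.+1 t),
  spin_extension c rho iota Z.
Proof.
have [c_alg _] := c_irr; rewrite /k.
case: t rho rhoP => /= r rP.
- exists idfun, (fun=> 0); apply: spin_extension_real => // a v.
  by rewrite rP sigmaE.
- have [J JP rE] := rP; eexists; eexists.
  exact: (spin_extension_complex c_alg sigmaE JP rE).
have [I [J [IJP rE]]] := rP; eexists; eexists.
exact: (spin_extension_quaternionic c_alg sigmaE IJP rE).
Qed.

(* Eliminates the ratio of the two weights. *)
Lemma spin_ext_equation : of_lie_type rho ->
  (N - ((n - 4) ^+ 2 - n)) * (N + 2 * k%:R - 4) = 2 * k%:R * (n * (n - 1)).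
Proof.
have [iota [Z se]] := spin_ext_extension.
case/(spin_lie_type_equations m4 V_gt0 c_irr.1 se) => l [u [l_gt0 u_gt0 e1 e2]].
rewrite -/N -/n -/k in e1 e2.
have l0 : l != 0 by rewrite gt_eqF.
apply: (mulfI l0).
(* For k = 0 the second weight equation is absent, but the first already makes N - d vanish. *)
case: (posnP k) => [k0|k_gt0].
  rewrite k0 in e1 *.
  have -> : l * ((N - ((n - 4) ^+ 2 - n)) * (N + 2 * 0%:R - 4)) =
    (N * l - l * ((n - 4) ^+ 2 - n)) * (N - 4) by ring.
  by rewrite e1; ring.
have -> : l * ((N - ((n - 4) ^+ 2 - n)) * (N + 2 * k%:R - 4)) =
  (N * l - l * ((n - 4) ^+ 2 - n)) * (N + 2 * k%:R - 4) by ring.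
rewrite e1; have := e2 k_gt0 => {}e2.
have -> : (l * ((n - 4) ^+ 2 - n) + 2 * k%:R * u - l * ((n - 4) ^+ 2 - n)) *
  (N + 2 * k%:R - 4) = 2 * k%:R * (u * (N + 2 * k%:R - 4)) by ring.
by rewrite e2; ring.
Qed.

Lemma spin_ext_lie_type (u : R) : 0 < u ->
  N <= (n - 4) ^+ 2 - n + 2 * k%:R * u ->
  ((0 < k)%N -> u * (N + 2 * k%:R - 4) <= n * (n - 1)) ->
  of_lie_type rho.
Proof.
have [iota [Z se]] := spin_ext_extension.
exact: (spin_lie_type_inequations m4 V_gt0 c_irr.1 se).
Qed.

End SpinExtLieType.

(** * Arithmetic of the dimension equations *)

Section Numerics.
Local Open Scope ring_scope.

(** For n = 7 and 15, where k = 0, the roots 2, 4 and 4, 106 of the quadratic in N are below the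
    lower bounds 8 and 128. For n = 11, 13 and 14, its positive root lies strictly between 50 and
    51, 79 and 80, 90 and 91. *)
Lemma no_solution_small (R : realType) (N k n : nat) :
  (n, k) \in [:: (7, 0); (11, 3); (13, 3); (14, 1); (15, 0)]%N ->
  (2 ^ n.-1./2.*2 <= N ^ 2)%N ->
  (N%:R - ((n%:R - 4) ^+ 2 - n%:R)) * (N%:R + 2 * k%:R - 4) =
    2 * k%:R * (n%:R * (n%:R - 1)) :> R -> False.
Proof.
have nat_eq (a b : nat) : a%:R = b%:R :> R -> a = b.
  by move=> /eqP; rewrite eqr_nat => /eqP.
rewrite !inE !xpair_eqE; do ![case/orP] => /andP[/eqP -> /eqP ->] /= leN eN.
- have : (N * N + 8 = 6 * N)%N.
    by apply: nat_eq; rewrite natrD !natrM; move: eN; lra.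
  by move: leN; rewrite -mulnn; nia.
- have : (N * N = 36 * N + 736)%N.
    by apply: nat_eq; rewrite natrD !natrM; move: eN; lra.
  by have [le_N|gt_N] := leqP N 50; nia.
- have : (N * N = 66 * N + 1072)%N.
    by apply: nat_eq; rewrite natrD !natrM; move: eN; lra.
  by have [le_N|gt_N] := leqP N 79; nia.
- have : (N * N = 88 * N + 192)%N.
    by apply: nat_eq; rewrite natrD !natrM; move: eN; lra.
  by have [le_N|gt_N] := leqP N 90; nia.
have : (N * N + 424 = 110 * N)%N.
  by apply: nat_eq; rewrite natrD !natrM; move: eN; lra.
move: leN; rewrite -mulnn; nia.
Qed.

(** For j = n - 17 this is (n - 4)^4 <= 2^(n - 2). It starts from 13^4 = 28561 <= 32768 = 2^15, and
    the left side less than doubles at each step. *)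
Lemma exp2_ge_pow4 j : ((j + 13) ^ 4 <= 2 ^ (j + 15))%N.
Proof.
elim: j => [|j IHj] //; rewrite !addSn [leqRHS]expnS.
apply: leq_trans (leq_mul (leqnn 2) IHj).
by rewrite !expnS !expn0; nia.
Qed.

(** As N >= (n - 4)^2, the factor N - d is at least n and the other exceeds 2 k (n - 1), so the left
    side is too large. *)
Lemma no_solution_large (R : realType) (N k n : nat) :
  (17 <= n)%N -> k \in [:: 0; 1; 3]%N -> (2 ^ n.-1./2.*2 <= N ^ 2)%N ->
  (N%:R - ((n%:R - 4) ^+ 2 - n%:R)) * (N%:R + 2 * k%:R - 4) =
    2 * k%:R * (n%:R * (n%:R - 1)) :> R -> False.
Proof.
move=> n17 kP leN eN.
have leN' : ((n - 4) ^ 2 <= N)%N.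
  (* The squares are compared, using n - 2 <= 2 floor((n - 1) / 2). *)
  rewrite -(leq_exp2r _ _ (isT : 0 < 2)%N) -expnM; apply: leq_trans leN.
  have -> : (n - 4 = n - 17 + 13)%N by lia.
  apply: leq_trans (exp2_ge_pow4 _) _; rewrite leq_exp2l //.
  by have := odd_double_half n.-1; case: (odd _); lia.
have N_ge : (n%:R - 4) ^+ 2 <= N%:R :> R.
  by rewrite -(natrB R (leq_trans (isT : 4 <= 17)%N n17)) -natrX ler_nat.
have n_ge : 17 <= n%:R :> R by rewrite (ler_nat R 17).
move: (N%:R : R) (n%:R : R) N_ge n_ge eN => {leN leN' n17}{}N {}n N_ge n_ge eN.
have b_gt : 2 * k%:R * (n - 1) < N + 2 * k%:R - 4.
  by move: kP; rewrite !inE => /or3P[] /eqP->; nra.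
have k_ge0 : 0 <= 2 * k%:R * (n - 1) :> R.
  by rewrite mulr_ge0 ?mulr_ge0 ?ler0n //; lra.
set a := N - ((n - 4) ^+ 2 - n) in eN; set b := N + 2 * k%:R - 4 in eN b_gt.
have ab : 0 <= (a - n) * b by rewrite mulr_ge0 // /a; lra.
have nb : 0 < n * (b - 2 * k%:R * (n - 1)) by rewrite mulr_gt0 //; lra.
move: ab nb eN; lra.
Qed.

End Numerics.

(** The weight inequalities, with l = 1 and the bound d in place of N, are written over the naturals
    without subtraction, so that each case is decided by computation. *)
Lemma spinor_lie_type (R : realType) (m d u : nat) (V : vectType R)
    (sigma : lie_spin R m.+1 -> V -> V) (c : Cl R m -> V -> V)
    (t : rep_type) (rho : spin_ext R m.+1 t -> V -> V) :
  let n := m.+1 in let k := ext_rank t in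
  [&& 4 <= m, 0 < u, d + 9 * n <= n * n + 16 + 2 * k * u &
      (0 < k) ==> (u * (d + 2 * k) + n <= n * n + 4 * u)] ->
  irreducible_algebra_rep c -> (forall a v, sigma a v = c (vsval a) v) ->
  spin_ext_action sigma rho -> \dim {:V} <= d -> of_lie_type rho.
Proof.
move=> n k /and4P[m4 u_gt0 le1 /implyP le2] c_irr sigmaE rhoP le_d.
have le_dR : ((\dim {:V})%:R <= d%:R :> R)%R by rewrite ler_nat.
apply: (spin_ext_lie_type m4 c_irr sigmaE rhoP (u := u%:R%R)).
- by rewrite ltr0n.
- have : ((d + 9 * n)%:R <= (n * n + 16 + 2 * k * u)%:R :> R)%R by rewrite ler_nat.
  by rewrite !natrD !natrM -/n -/k; move: le_dR; lra.
move=> /le2; rewrite -(ler_nat R) !natrD !natrM natrD natrM -/n -/k.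
have : (u%:R * (\dim {:V})%:R <= u%:R * d%:R :> R)%R by rewrite ler_wpM2l ?ler0n.
by lra.
Qed.

Theorem proposition4p2 (R : realType) (n : nat) (n_ge5 : 5 <= n)
    (V : vectType R)
    (sigma : lie_spin R n -> V -> V) (sigmaP : plus_spinor_rep sigma)
    (rho : spin_tilde R n -> V -> V) (rhoP : spin_tilde_action sigma rho) :
  of_lie_type rho <-> n \in [:: 5; 6; 8; 9; 10; 12; 16].
Proof.
case: n => [//|m] in n_ge5 sigma sigmaP rho rhoP *.
have m4 : 4 <= m by [].
have [c c_irr sigmaE] := spinor_clifford sigmaP.
have dim_le d := @spinor_dim_le R V m d c c_irr.
split=> [lie|].
  have eqN := spin_ext_equation m4 c_irr sigmaE rhoP lie.
  have leN := spinor_dim_ge c_irr.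
  apply/negPn/negP => n_notin.
  have [n17|n16] := leqP 17 m.+1.
    apply: (no_solution_large n17 _ leN eqN).
    by case: (spinor_type m.+1).
  apply: (@no_solution_small _ _ _ m.+1 _ leN eqN).
  (* The values of n left are 7, 11, 13, 14 and 15, and k is computed from [spinor_type]. *)
  move: n_notin n16 m4; clear.
  by do 16![case: m => [//|m]].
have lie d u ok := @spinor_lie_type R m d u V sigma c _ rho ok c_irr sigmaE rhoP.
rewrite !inE; do ![case/orP] => /eqP[me]; subst m.
(* The second number is the weight u: with l = 1 and N = d it solves the weight equations. For n =
   8, 9 and 16 there are no units and u = 1 is a default. *)
- exact: (lie 8 2 isT (dim_le 8 isT)).
- exact: (lie 8 5 isT (dim_le 8 isT)).
- exact: (lie 8 1 isT (dim_le 8 isT)).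
- exact: (lie 16 1 isT (dim_le 16 isT)).
- exact: (lie 32 3 isT (dim_le 32 isT)).
- exact: (lie 64 2 isT (dim_le 64 isT)).
exact: (lie 128 1 isT (dim_le 128 isT)).
Qed.
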